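(* Let $\xi$ be a non-negative integer-valued random variable with $\mathbb{E}\xi=1$ and $0<\mathrm{Var}(\xi)<\infty$, let $\mathcal{T}$ be the Galton-Watson tree with offspring distribution $\xi$, and let $\mathcal{T}_n$ be $\mathcal{T}$ conditioned on $|\mathcal{T}|=n$. Let $\mathcal{S}^+_{\le k}$ be the set of plane trees $T$ with $|T|\le k$ and $\mathbb{P}(\mathcal{T}=T)>0$, and let $p^{\min}_k:=\min_{T\in\mathcal{S}^+_{\le k}}\mathbb{P}(\mathcal{T}=T)$. Assume that, as $i\to\infty$, $$\log(1/p^{\min}_i)=\gamma(\log i)(i+O(1)),$$ where $\gamma>0$ is a constant. Define $m=\log n$, $m_1=\log(m/\gamma)$, $m_2=\log m_1$. Let $k_n\to\infty$ be a sequence of positive integers. Then for all constants $\delta>0$: (i) if $k_n\le\dfrac{m}{\gamma(m_1-m_2)}\left(1-(1+\delta)\dfrac{m_2}{m_1(m_1-m_2)}\right)$, then with high probability $\mathcal{T}_n$ contains all trees in $\mathcal{S}^+_{\le k_n}$ as fringe subtrees; (ii) if $k_n\ge\dfrac{m}{\gamma(m_1-m_2)}\left(1-(1-\delta)\dfrac{m_2}{m_1(m_1-m_2)}\right)$, then with high probability $\mathcal{T}_n$ does not contain all trees in $\mathcal{S}^+_{\le k_n}$ as fringe subtrees. Thus, as $n\to\infty$, with $K_n:=\max\{k:\text{every tree in }\mathcal{S}^+_{\le k}\text{ is a fringe subtree of }\mathcal{T}_n\}$, $$K_n\frac{\log\log n}{\log n}\to\frac1\gamma\quad\text{in probability,}$$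 and more precisely, $$\left[\frac{K_n\,\gamma\left[\log\frac{\log n}{\gamma}-\log\log\frac{\log n}{\gamma}\right]}{\log n}-1\right]\times\frac{(\log\log n)^2}{\log\log\log n}\to-1\quad\text{in probability.}$$
   Context: A plane tree is a finite rooted, ordered, unlabeled tree; $|T|$ is its number of nodes. For a node $v$ of $T$, the fringe subtree $T_v$ consists of $v$ and all its descendants; $T$ contains $T'$ as a fringe subtree if $T_v$ is isomorphic (as a plane tree) to $T'$ for some $v$. The Galton-Watson tree is generated from the root by giving each node independently a number of children distributed as $\xi$. Let $p_i=\mathbb{P}(\xi=i)$ and $h=\gcd\{i\ge1:p_i>0\}$; then $\mathbb{P}(|\mathcal{T}|=n)>0$ for all large $n\equiv1\pmod h$, and all limits as $n\to\infty$ are along such $n$. ''With high probability'' means with probability tending to $1$ as $n\to\infty$. *)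

(* Defs.v *)
From mathcomp Require Export all_boot all_order all_algebra.
From mathcomp Require Export all_classical all_reals all_analysis.
Export numFieldNormedType.Exports.
Set Implicit Arguments.
Unset Strict Implicit.
Unset Printing Implicit Defensive.
Import Order.TTheory GRing.Theory Num.Theory.
Local Open Scope classical_set_scope.
Local Open Scope ring_scope.

(* [tree] has no labels, so isomorphism of plane trees is Leibniz equality. *)
Inductive tree : Type := Node of seq tree.

Definition children (t : tree) : seq tree := let: Node ts := t in ts.

Fixpoint tsize (t : tree) : nat :=
  let: Node ts := t in (sumn (map tsize ts)).+1.

(* Nodes are addressed by the sequence of child indices (from 0) on the path
   from the root; [subtree_at t u] is the fringe subtree of [t] at the node
   with address [u], and [None] if [t] has no such node. *)
Fixpoint subtree_at (t : tree) (u : seq nat) : option tree :=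
  if u is i :: u' then
    if onth (children t) i is Some c then subtree_at c u' else None
  else Some t.

Definition fringe_subtree (t s : tree) : Prop :=
  exists u, subtree_at t u = Some s.

Definition mutually_independent (d d' : measure_display) (I : eqType)
    (Omega : measurableType d) (S : measurableType d') (R : realType)
    (P : probability Omega R) (X : I -> {RV P >-> S}) : Prop :=
  forall (s : seq I) (A : I -> set S), uniq s ->
    (forall u, measurable (A u)) ->
    P [set w | forall u, u \in s -> A u (X u w)] =
      (\prod_(u <- s) P (X u @^-1` A u))%E.

Definition iid_copies (d d' : measure_display) (I : eqType)
    (Omega : measurableType d) (S : measurableType d') (R : realType)
    (P : probability Omega R) (xi : {RV P >-> S}) (X : I -> {RV P >-> S})
    : Prop :=
  mutually_independent X /\
  forall u (A : set S), measurable A -> distribution P (X u) A = distribution P xi A.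

(* [is_span xi h]: h = gcd {i >= 1 : P(xi = i) > 0}. *)
Definition is_span (d : measure_display) (Omega : measurableType d)
    (R : realType) (P : probability Omega R) (xi : {RV P >-> nat}) (h : nat)
    : Prop :=
  let supp := [set i : nat | (1 <= i)%N /\ (0 < P (xi @^-1` [set i]))%E] in
  (forall i, supp i -> (h %| i)%N) /\
  (forall g : nat, (forall i, supp i -> (g %| i)%N) -> (g %| h)%N).

(* The Galton-Watson tree grown from the offspring numbers [X u w] (number of
   children of the potential node with address [u]) equals the finite tree
   [t]; for given [w] this holds for at most one [t], and for none when the
   Galton-Watson tree is infinite. *)
Definition gw_tree_is (d : measure_display) (Omega : measurableType d)
    (R : realType) (P : probability Omega R)
    (X : seq nat -> {RV P >-> nat}) (w : Omega) (t : tree) : Prop :=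
  forall u s, subtree_at t u = Some s -> X u w = size (children s).

Definition gw_prob (d : measure_display) (Omega : measurableType d)
    (R : realType) (P : probability Omega R)
    (X : seq nat -> {RV P >-> nat}) (A : set tree) : R :=
  fine (P [set w | exists2 t, A t & gw_tree_is X w t]).

(* Law of the Galton-Watson tree conditioned to have [n] nodes. It is the
   constant 0 when the conditioning event has probability 0. *)
Definition gw_cond_prob (d : measure_display) (Omega : measurableType d)
    (R : realType) (P : probability Omega R)
    (X : seq nat -> {RV P >-> nat}) (n : nat) (A : set tree) : R :=
  gw_prob X (A `&` [set t | tsize t = n]) / gw_prob X [set t | tsize t = n].

Definition Splus (d : measure_display) (Omega : measurableType d)
    (R : realType) (P : probability Omega R)
    (X : seq nat -> {RV P >-> nat}) (k : nat) : set tree :=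
  [set t | (tsize t <= k)%N /\ 0 < gw_prob X [set t]].

(* [Splus X k] is finite, so the infimum is a minimum when it is nonempty. *)
Definition pmin (d : measure_display) (Omega : measurableType d)
    (R : realType) (P : probability Omega R)
    (X : seq nat -> {RV P >-> nat}) (k : nat) : R :=
  inf [set gw_prob X [set t] | t in Splus X k].

Definition contains_all (d : measure_display) (Omega : measurableType d)
    (R : realType) (P : probability Omega R)
    (X : seq nat -> {RV P >-> nat}) (k : nat) : set tree :=
  [set t | forall s, Splus X k s -> fringe_subtree t s].

(* max {k : t contains all trees in Splus X k}; the default 0 is only used if
   this set has no maximum. *)
Definition Kmax (d : measure_display) (Omega : measurableType d)
    (R : realType) (P : probability Omega R)
    (X : seq nat -> {RV P >-> nat}) (t : tree) : nat :=
  xget 0%N [set k | contains_all X k t /\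
                    forall j, contains_all X j t -> (j <= k)%N].

(* n -> oo along n = 1 mod h *)
Definition span_oo (h : nat) : set_system nat :=
  within [set n : nat | (n = 1 %[mod h])%N] \oo.

Definition whp (d : measure_display) (Omega : measurableType d)
    (R : realType) (P : probability Omega R)
    (X : seq nat -> {RV P >-> nat}) (h : nat) (A : nat -> set tree) : Prop :=
  gw_cond_prob X n (A n) @[n --> span_oo h] --> (1 : R).

(* f n (T_n) converges to c in probability, T_n being the conditioned tree. *)
Definition cvg_in_prob (d : measure_display) (Omega : measurableType d)
    (R : realType) (P : probability Omega R)
    (X : seq nat -> {RV P >-> nat}) (h : nat) (f : nat -> tree -> R) (c : R)
    : Prop :=
  forall eps : R, 0 < eps ->
    gw_cond_prob X n [set t | eps < `|f n t - c|] @[n --> span_oo h] --> (0 : R).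

Definition threshold (R : realType) (gamma c : R) (n : nat) : R :=
  let m := ln n%:R in
  let m1 := ln (m / gamma) in
  let m2 := ln m1 in
  m / (gamma * (m1 - m2)) * (1 - c * (m2 / (m1 * (m1 - m2)))).

(* Main.v *)
Require Import Defs.
From mathcomp Require Import all_boot all_order all_algebra.
From mathcomp Require Import all_classical all_reals all_analysis.
From mathcomp Require Import measurable_realfun zify ring lra.
Import Order.TTheory GRing.Theory Num.Theory numFieldNormedType.Exports.
Set Implicit Arguments.
Unset Strict Implicit.
Unset Printing Implicit Defensive.
Local Open Scope classical_set_scope.
Local Open Scope ring_scope.

(** Why the theorem holds.

    A tree of size [k] costs [ln (1 / p) <= gamma * ln k * (k + O(1))], and the
    threshold for [k] is where this cost meets [ln n]. Writing
    [x = ln (ln n / gamma)], so that [ln n = gamma * exp x], the equation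
    [k * ln k = exp x] has the solution
    [exp x / (x - ln x) * (1 - (1 + o(1)) * rho)] with
    [rho = ln x / (x * (x - ln x))]. A factor [1 - c * rho] with [c <> 1] thus
    lowers the cost by about [(c - 1) * rho * ln n], which is much larger than any
    power of [ln k] (log_cost_below, log_cost_above). A factor
    [exp (C * (ln k) ^ 2)] in the probabilistic estimates can therefore be
    afforded, and the following two crude estimates suffice. Let [W s] be the
    probability that the unconditioned tree is [s], and [a_n] the probability
    that it has [n] nodes.

    - The conditioned tree misses [s] with probability at most
      [(1 - W s) ^ (n / |s|) / a_n]. Indeed, before conditioning, its preorder
      code consists of independent letters, and the code of [s] is absent from
      each of the [n / |s|] disjoint blocks of that word (word_sum_avoid). A union
      bound over the trees of size at most [k] gives part (i): below the
      threshold, [n * W s] exceeds every fixed power of [ln n], whereas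
      the number of trees and [1 / a_n] are at most exponentials of such
      powers.
    - The conditioned tree contains [s] with probability at most
      [n * W s / a_|s|]. Indeed the occurrence of [s] at a given position can be
      exchanged against any other tree of the same size
      (tree_weight_contain). Applied to the least likely tree [s], this
      gives part (ii).

    Both need a lower bound on the probability of a tree size, namely
    [a_n >= exp (- C * (1 + (ln n) ^ 2))] for all sizes that occur
    (tree_weight_ge). The generating function [T] of the tree size solves
    [T z = z * phi (T z)], where [phi] is that of the offspring number, and by
    the criticality and the finite variance
    [phi (1 - s) - (1 - s)] is of order [s ^ 2]; hence [1 - T (1 - eps)] is of
    order [sqrt eps] (tree_gf_le, tree_gf_ge). Comparing this at scales
    [eps = 1 / x] that differ by a constant factor shows that each window
    [(x, L * x]] carries a mass of order at least [1 / sqrt x], hence a size of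
    probability at least of order [x ^ (- 2)] (tree_weight_window). Finally
    grafting a tree at the last leaf of another one shows
    [a_(x + y + 1) >= a_(x + 1) * a_(y + 1)] (tree_weight_graft), so that an
    arbitrary size can be split into logarithmically many such sizes.

    The two limits for [Kmax] follow from parts (i) and (ii), applied to the
    integers next to the thresholds with [1 + delta] and [1 - delta]
    (Kmax_sandwich). *)

(** * Preorder codes of plane trees *)

Fixpoint code (t : tree) : seq nat :=
  let: Node ts := t in size ts :: flatten (map code ts).

Definition forest_code (ts : seq tree) : seq nat := flatten (map code ts).

(** The number [j] counts the trees still to be read, so [codes_forest c j]
    decides whether [c] is the concatenation of the codes of [j] trees. *)
Fixpoint codes_forest (c : seq nat) (j : nat) : bool :=
  if c is d :: c' then (0 < j)%N && codes_forest c' (j.-1 + d) else j == 0%N.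

(** Reading a code from right to left, a symbol [d] gathers the [d] most
    recently completed trees under a new root. *)
Definition decode_forest : seq nat -> seq tree :=
  foldr (fun d ts => Node (take d ts) :: drop d ts) [::].

Definition decode (c : seq nat) : tree := head (Node [::]) (decode_forest c).

(** The automatic principle of the nested type [tree] gives no hypothesis on the
    children. *)
Lemma tree_ind_children (Q : tree -> Prop) :
  (forall ts, (forall i t, onth ts i = Some t -> Q t) -> Q (Node ts)) ->
  forall t, Q t.
Proof.
move=> IH; fix F 1; case=> ts; apply: IH.
elim: ts => [|t ts IHts] [|i] s /=; first discriminate.
- discriminate.
- by case=> <-; apply: F.
- exact: IHts.
Qed.

Lemma all_childrenP (Q : tree -> Prop) (ts : seq tree) :
  (forall i t, onth ts i = Some t -> Q t) -> foldr (fun t => and (Q t)) True ts.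
Proof.
elim: ts => //= t ts IH H; split; first exact: (H 0%N).
by apply: IH => i; apply: (H i.+1).
Qed.

Lemma size_code t : size (code t) = Defs.tsize t.
Proof.
elim/tree_ind_children: t => ts /all_childrenP IH /=; congr _.+1.
by elim: ts IH => //= t ts IHts [ht] /IHts; rewrite size_cat ht => ->.
Qed.

Lemma foldr_decode_code st t :
  foldr (fun d ts => Node (take d ts) :: drop d ts) st (code t) = t :: st.
Proof.
elim/tree_ind_children: t st => ts /all_childrenP IH st /=.
suff -> : foldr (fun d ts0 => Node (take d ts0) :: drop d ts0) st
    (flatten (map code ts)) = ts ++ st.
  by rewrite take_size_cat ?drop_size_cat.
by elim: ts IH => //= t ts IHts [ht] /IHts h; rewrite foldr_cat h ht.
Qed.

Lemma decode_forestK ts : decode_forest (forest_code ts) = ts.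
Proof.
rewrite /decode_forest /forest_code; elim: ts => //= t ts IH.
by rewrite foldr_cat IH foldr_decode_code.
Qed.

Lemma codeK : cancel code decode.
Proof. by move=> t; rewrite /decode /decode_forest foldr_decode_code. Qed.

Lemma codes_forest_decode c j : codes_forest c j ->
  size (decode_forest c) = j /\ forest_code (decode_forest c) = c.
Proof.
elim: c j => [|d c IH] j /=; first by move/eqP->.
case: j => //= j /IH [hs hc]; split.
  by rewrite size_drop hs addnK.
rewrite /forest_code /= size_takel ?hs ?leq_addl //.
by rewrite -flatten_cat -map_cat cat_take_drop -[RHS]/(d :: c) -{2}hc.
Qed.

Lemma decodeK c : codes_forest c 1 -> code (decode c) = c.
Proof.
move/codes_forest_decode => [hs hc]; rewrite -[RHS]hc /decode; move: hs {hc}.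
by case: (decode_forest c) => [|t []] //= _; rewrite /forest_code /= cats0.
Qed.

(** Codes of trees are prefix-free: reading one consumes exactly one of the
    pending trees. *)
Lemma codes_forest_code t v j :
  codes_forest (code t ++ v) j.+1 = codes_forest v j.
Proof.
elim/tree_ind_children: t v j => ts /all_childrenP IH v j /=.
rewrite addnC; elim: ts IH => [|t ts IHts] /= IH //.
by case: IH => ht /IHts h; rewrite -catA addSn ht h.
Qed.

Lemma codes_forest_code1 t : codes_forest (code t) 1.
Proof. by rewrite -[code t]cats0 codes_forest_code. Qed.

Lemma codes_forest_catr e v j : codes_forest e 1 ->
  codes_forest (e ++ v) j = (0 < j)%N && codes_forest v j.-1.
Proof.
move=> /decodeK <-; case: j => [|j] /=; last exact: codes_forest_code.
by case: (decode e).
Qed.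

(** What is pending after a tree does not depend on the tree. This is the basis
    of all surgery on codes below. *)
Lemma codes_forest_replace u e e' v j : codes_forest e 1 -> codes_forest e' 1 ->
  codes_forest (u ++ e ++ v) j = codes_forest (u ++ e' ++ v) j.
Proof.
move=> he he'; elim: u j => [|d u IH] j /=; last by rewrite IH.
by rewrite !codes_forest_catr.
Qed.

(** Each pending tree needs at least one symbol. *)
Lemma codes_forest_short c j : (size c < j)%N -> codes_forest c j = false.
Proof.
elim: c j => [|d c IH] [|j] //= hs; apply: IH.
by apply: leq_trans (leq_addr _ _).
Qed.

Lemma codes_forest_rcons_last c d : codes_forest (rcons c d) 1 -> d = 0%N.
Proof.
move: {1}1%N => j; elim: c j => [|x c IH] j /=.
  by move=> /andP[_]; rewrite addn_eq0 => /andP[_ /eqP].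
by move=> /andP[_ /IH].
Qed.

Lemma infix_forest_code ts i c :
  onth ts i = Some c -> infix (code c) (forest_code ts).
Proof.
elim: ts i => [|t ts IH] [|i] //= E.
  by case: E => ->; apply: prefixW; apply: prefix_prefix.
exact: infix_catl (IH i E).
Qed.

Lemma subtree_at_code t u s : subtree_at t u = Some s -> infix (code s) (code t).
Proof.
elim: u t => [|i u IH] t /=; first by case=> ->; apply: infix_refl.
case: t => ts /=; case E : (onth ts i) => [c|//] /IH h.
by apply/orP; right; apply: infix_trans h (infix_forest_code E).
Qed.

(** An occurrence of the code of [s] in a forest code starts at some node, and
    since codes are prefix-free the subtree of that node is [s]. *)
Lemma infix_code_subtree ts s u v : forest_code ts = u ++ code s ++ v ->
  exists i t, onth ts i = Some t /\ fringe_subtree t s.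
Proof.
elim: u ts => [|d u IH] ts /=.
  move/(congr1 decode_forest); rewrite decode_forestK /decode_forest foldr_cat.
  by rewrite foldr_decode_code => ->; exists 0%N, s; split => //; exists [::].
case: ts => [|[cs] ts] //; rewrite /forest_code /= => -[_ e].
have /IH[i [t [it [w tw]]]] : forest_code (cs ++ ts) = u ++ code s ++ v.
  by rewrite /forest_code map_cat flatten_cat.
have [ics|csi] := ltnP i (size cs).
  exists 0%N, (Node cs); split=> //; exists (i :: w) => /=.
  by move: it; rewrite onth_cat ics => ->.
exists (i - size cs).+1, t; split; last by exists w.
by rewrite /= -it onth_cat ltnNge csi.
Qed.

Lemma fringe_subtreeP t s : fringe_subtree t s <-> infix (code s) (code t).
Proof.
split=> [[u /subtree_at_code//]|/infixP[u [v e]]].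
have e' : forest_code [:: t] = u ++ code s ++ v by rewrite /forest_code /= cats0.
have [[|[|i]] [t' [//= [<-]]]] := infix_code_subtree e'; exact.
Qed.

Lemma codes_forest_bound c j :
  codes_forest c j -> all (fun d => d + j <= size c)%N c.
Proof.
elim: c j => //= d c IH [|j] //= h; apply/andP; split.
  rewrite addnS ltnS addnC leqNgt; apply: contraL h => hs.
  by rewrite codes_forest_short.
by apply: sub_all (IH _ h) => x /=; lia.
Qed.

(** * Weighted sums over words *)

Fixpoint words (D n : nat) : seq (seq nat) :=
  if n is n'.+1 then [seq d :: c | d <- iota 0 D, c <- words D n']
  else [:: [::]].

Lemma mem_words D n c :
  (c \in words D n) = (size c == n) && all (fun d => d < D)%N c.
Proof.
elim: n c => [|n IH] [|d c] //=.
  by apply/negbTE/negP => /allpairsP[[]] /= ? ? [].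
apply/allpairsP/idP => [[[x y]] /= [hx hy [-> ->]]|].
  by move: hx hy; rewrite mem_iota IH /= eqSS => -> /andP[-> ->].
rewrite eqSS => /and3P[hs hd hc]; exists (d, c); split=> //=.
  by rewrite mem_iota.
by rewrite IH hs.
Qed.

Lemma uniq_words D n : uniq (words D n).
Proof.
elim: n => //= n IH; apply: allpairs_uniq => //; first exact: iota_uniq.
by move=> [x y] [x' y'] _ _ /= [-> ->].
Qed.

Lemma size_words D n : size (words D n) = (D ^ n)%N.
Proof. by elim: n => //= n IH; rewrite size_allpairs size_iota IH expnS. Qed.

Section WordSums.
Variables (R : realType) (p : nat -> R).

Definition weight (c : seq nat) : R := \prod_(d <- c) p d.

(** The expectation of [g] over [n] independent letters with law [p], restricted
    to letters below [D]. The truncation keeps all sums finite. *)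
Definition word_sum (D n : nat) (g : seq nat -> R) : R :=
  \sum_(c <- words D n) weight c * g c.

Lemma word_sum0 D g : word_sum D 0 g = g [::].
Proof. by rewrite /word_sum /= big_seq1 /weight big_nil mul1r. Qed.

Lemma word_sumS D n g :
  word_sum D n.+1 g = \sum_(d < D) p d * word_sum D n (fun c => g ((d : nat) :: c)).
Proof.
rewrite /word_sum /= big_allpairs_dep /= -(big_mkord xpredT
  (fun d => p d * \sum_(c <- words D n) weight c * g (d :: c))) /index_iota subn0.
apply: eq_bigr => d _; rewrite big_distrr /=; apply: eq_bigr => c _.
by rewrite /weight big_cons mulrA.
Qed.

Lemma eq_word_sum D n g g' : (forall c, size c = n -> g c = g' c) ->
  word_sum D n g = word_sum D n g'.
Proof.
move=> h; rewrite /word_sum !big_seq; apply: eq_bigr => c.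
by rewrite mem_words => /andP[/eqP /h ->].
Qed.

Lemma word_sum_cat D m n g : word_sum D (m + n) g =
  word_sum D m (fun u => word_sum D n (fun v => g (u ++ v))).
Proof.
elim: m g => [|m IH] g; first by rewrite word_sum0.
by rewrite addSn !word_sumS; apply: eq_bigr => d _; rewrite IH.
Qed.

Lemma word_sumZr D n g a :
  word_sum D n (fun c => g c * a) = word_sum D n g * a.
Proof.
by rewrite /word_sum big_distrl; apply: eq_bigr => c _; rewrite mulrA.
Qed.

Lemma word_sum_add D n g g' :
  word_sum D n (fun c => g c + g' c) = word_sum D n g + word_sum D n g'.
Proof. by rewrite /word_sum -big_split; apply: eq_bigr => c _; rewrite mulrDr. Qed.

Lemma word_sum_sum (I : Type) (r : seq I) D n (g : I -> seq nat -> R) :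
  word_sum D n (fun c => \sum_(i <- r) g i c) = \sum_(i <- r) word_sum D n (g i).
Proof.
rewrite /word_sum exchange_big; apply: eq_bigr => c _.
by rewrite big_distrr.
Qed.

Hypothesis p_ge0 : forall d, 0 <= p d.

Lemma weight_ge0 c : 0 <= weight c.
Proof. exact: prodr_ge0. Qed.

Lemma ler_word_sum D n g g' : (forall c, size c = n -> g c <= g' c) ->
  word_sum D n g <= word_sum D n g'.
Proof.
move=> h; rewrite /word_sum !big_seq; apply: ler_sum => c.
rewrite mem_words => /andP[/eqP /h hc _].
by apply: ler_wpM2l => //; apply: weight_ge0.
Qed.

Lemma word_sum_ge0 D n g : (forall c, 0 <= g c) -> 0 <= word_sum D n g.
Proof. by move=> h; apply: sumr_ge0 => c _; rewrite mulr_ge0 ?weight_ge0. Qed.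

Lemma word_sum_delta D n e (F : R) : e \in words D n ->
  word_sum D n (fun c => (c == e)%:R * F) = weight e * F.
Proof.
move=> he; rewrite /word_sum (bigD1_seq e) ?uniq_words //= eqxx mul1r.
by rewrite big1 ?addr0 // => c /negbTE ->; rewrite mul0r mulr0.
Qed.

Hypothesis p_sum_le1 : forall D, \sum_(d < D) p d <= 1.

Lemma word_sum1_le1 D n : word_sum D n (fun=> 1) <= 1.
Proof.
elim: n => [|n IH]; first by rewrite word_sum0.
rewrite word_sumS -big_distrl /=.
apply: mulr_ile1 IH => //; [exact: sumr_ge0|exact: word_sum_ge0|exact: p_sum_le1].
Qed.

(** A word without the factor [e] splits into [n %/ size e] blocks that all
    differ from [e], and disjoint blocks are independent. *)
Lemma word_sum_avoid D n e : (0 < size e)%N -> e \in words D (size e) ->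
  word_sum D n (fun c => (~~ infix e c)%:R) <= (1 - weight e) ^+ (n %/ size e).
Proof.
set k := size e => k0 he.
have we1 : weight e <= 1.
  apply: le_trans (word_sum1_le1 D k).
  rewrite -[leLHS]mulr1 -(word_sum_delta 1 he); apply: ler_word_sum => c _.
  by case: eqP; rewrite ?mul1r ?mul0r ?lexx.
have block : word_sum D k (fun c => (c != e)%:R) <= 1 - weight e.
  rewrite lerBrDr -[weight e]mulr1 -(word_sum_delta 1 he) -word_sum_add.
  apply: le_trans (word_sum1_le1 D k); apply: ler_word_sum => c _.
  by case: eqP => _ /=; rewrite ?mulr1 ?addr0 ?add0r lexx.
rewrite {1}(divn_eq n k) addnC; elim: (n %/ k)%N => [|q IH].
  rewrite expr0; apply: le_trans (word_sum1_le1 D _); apply: ler_word_sum => c _.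
  by rewrite lern1 leq_b1.
rewrite mulSn addnCA word_sum_cat exprS.
(* the first block differs from [e] and the remaining word avoids [e] *)
apply: (@le_trans _ _ (word_sum D k (fun c => (c != e)%:R *
   word_sum D (n %% k + q * k) (fun c => (~~ infix e c)%:R)))).
  apply: ler_word_sum => u su; case: eqP => [->|_] /=.
    rewrite mul0r /word_sum big1 // => v _.
    by rewrite prefix_infix /= mulr0.
  rewrite mul1r; apply: ler_word_sum => v _.
  by case: (boolP (infix e v)) => [/infix_catl ->|_] //=; case: (~~ _).
rewrite word_sumZr; apply: ler_pM => //; apply: word_sum_ge0 => c; exact: ler0n.
Qed.

(** ** The weight of the forests of given sizes *)

Definition forest_weight (D j n : nat) : R :=
  word_sum D n (fun c => (codes_forest c j)%:R).

(** A tree with [n] nodes has outdegrees below [n], so words over [0, n)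
    exhaust the codes. *)
Definition tree_weight (n : nat) : R := forest_weight n 1 n.

Lemma forest_weight_ge0 D j n : 0 <= forest_weight D j n.
Proof. by apply: word_sum_ge0 => c; apply: ler0n. Qed.

Lemma forest_weightn0 D j : forest_weight D j 0 = (j == 0%N)%:R.
Proof. by rewrite /forest_weight word_sum0. Qed.

Lemma forest_weight0S D n : forest_weight D 0 n.+1 = 0.
Proof.
rewrite /forest_weight word_sumS big1 // => d _.
by rewrite /word_sum big1 ?mulr0 // => c _; rewrite mulr0.
Qed.

Lemma forest_weightSS D j n :
  forest_weight D j.+1 n.+1 = \sum_(d < D) p d * forest_weight D (j + d) n.
Proof. by rewrite /forest_weight word_sumS. Qed.

Lemma forest_weight_short D j n : (n < j)%N -> forest_weight D j n = 0.
Proof.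
move=> nj; rewrite /forest_weight /word_sum big_seq big1 // => c.
rewrite mem_words => /andP[/eqP sc _].
by rewrite codes_forest_short ?sc ?mulr0.
Qed.

(** A letter [d] leaves at least [d] trees pending, so letters beyond the length
    do not occur in codes. *)
Lemma forest_weight_stable D D' j n : (n <= D)%N -> (D <= D')%N ->
  forest_weight D j n = forest_weight D' j n.
Proof.
elim: n j => [|n IH] j nD DD'; first by rewrite !forest_weightn0.
case: j => [|j]; first by rewrite !forest_weight0S.
rewrite !forest_weightSS -!(big_mkord xpredT (fun d => p d * forest_weight _ (j + d) n)).
rewrite [RHS](big_cat_nat (leq0n D)) //= [X in _ + X]big_nat [X in _ + X]big1.
  by rewrite addr0; apply: eq_bigr => d _; rewrite (IH _ (ltnW nD)).
move=> d /andP[Dd _]; rewrite forest_weight_short ?mulr0 //.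
by rewrite (leq_trans nD) ?(leq_trans Dd) ?leq_addl.
Qed.

Lemma tree_weightE D n : (n <= D)%N -> forest_weight D 1 n = tree_weight n.
Proof. by move=> nD; rewrite /tree_weight -(forest_weight_stable _ _ nD). Qed.

Lemma tree_weight_ge0 n : 0 <= tree_weight n.
Proof. exact: forest_weight_ge0. Qed.

Lemma code_in_words D e : codes_forest e 1 -> (size e <= D)%N ->
  e \in words D (size e).
Proof.
move=> /codes_forest_bound he sD; rewrite mem_words eqxx /=.
by apply: sub_all he => d /=; lia.
Qed.

Lemma weight_le_tree_weight e : codes_forest e 1 ->
  weight e <= tree_weight (size e).
Proof.
move=> he; rewrite -[leLHS]mulr1 -(word_sum_delta 1 (code_in_words he (leqnn _))).
apply: ler_word_sum => c _; case: eqP => [->|_]; last by rewrite mul0r.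
by rewrite he mul1r.
Qed.

(** The last symbol of a code is a leaf; a second tree may be grafted there,
    and the position of the graft is determined by the sizes. *)
Lemma tree_weight_graft x y :
  tree_weight x.+1 * tree_weight y.+1 <= tree_weight (x + y).+1.
Proof.
rewrite -addnS; have [D D0 hD] : {D | (0 < D)%N & (x + y.+1 <= D)%N}.
  by exists (x + y.+1)%N; rewrite ?addnS.
rewrite -(@tree_weightE D x.+1); last by lia.
rewrite -(@tree_weightE D y.+1); last by lia.
rewrite -(@tree_weightE D (x + y.+1)) // /forest_weight -[x.+1]addn1 !word_sum_cat.
apply: (@le_trans _ _ (word_sum D x (fun u => (codes_forest (u ++ [:: 0%N]) 1)%:R) *
  word_sum D y.+1 (fun v => (codes_forest v 1)%:R))).
  apply: ler_wpM2r; first exact: forest_weight_ge0.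
  apply: ler_word_sum => u _; case: D D0 {hD} => // D _; rewrite word_sumS big_ord_recl word_sum0 /=.
  rewrite big1 ?addr0 => [|d _].
    have p01 : p 0 <= 1 by have := p_sum_le1 1; rewrite big_ord1.
    by apply: ler_piMl.
  rewrite word_sum0 cats1; case E: codes_forest; last by rewrite mulr0.
  by have := codes_forest_rcons_last E.
rewrite -word_sumZr; apply: ler_word_sum => u _.
rewrite mulrC -word_sumZr; apply: ler_word_sum => v _.
case hv: (codes_forest v 1); last by rewrite mul0r.
rewrite mul1r -[v]cats0 -[[:: 0%N]]cats0.
by rewrite (codes_forest_replace _ _ _ hv (_ : codes_forest [:: 0%N] 1)).
Qed.

(** Exchanging an occurrence of [e] at a fixed position against an arbitrary
    tree of the same size turns a code that contains [e] into a code. *)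
Lemma tree_weight_contain D n e : codes_forest e 1 -> (n <= D)%N ->
  word_sum D n (fun c => (codes_forest c 1 && infix e c)%:R) *
    tree_weight (size e) <= n%:R * weight e * tree_weight n.
Proof.
move=> he nD; set k := size e.
have k0 : (0 < k)%N by rewrite /k; case: (e) he.
have rhs0 : 0 <= weight e * tree_weight n.
  by apply: mulr_ge0; [exact: weight_ge0|exact: tree_weight_ge0].
have [nk|kn] := ltnP n k.
  rewrite /word_sum [X in X * _]big1_seq; first by rewrite mul0r -mulrA mulr_ge0.
  move=> c /=.
  rewrite mem_words => /andP[/eqP sc _]; case: infixP => [[u [v cE]]|_].
    by move: nk; rewrite -sc cE !size_cat -/k; lia.
  by rewrite andbF mulr0.
(* [at_ i c] says that [e] occurs in [c] at position [i]; there are at most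
   [n - k + 1 <= n] positions *)
pose at_ i c := codes_forest c 1 && (take k (drop i c) == e).
apply: (@le_trans _ _ ((\sum_(0 <= i < (n - k).+1)
   word_sum D n (fun c => (at_ i c)%:R)) * tree_weight k)).
  apply: ler_wpM2r; first exact: tree_weight_ge0.
  rewrite -word_sum_sum; apply: ler_word_sum => c sc.
  case: (boolP (_ && _)) => [/andP[hc /infixP[u [v cE]]]|_]; last first.
    by apply: sumr_ge0 => i _; apply: ler0n.
  have sE : (size u + (k + size v))%N = n by rewrite -sc cE !size_cat.
  have hu : size u \in index_iota 0 (n - k).+1 by rewrite mem_index_iota; lia.
  rewrite (bigD1_seq (size u) hu (iota_uniq _ _)) /=.
  rewrite /at_ hc {1}cE drop_size_cat // take_size_cat // eqxx /= lerDl.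
  by apply: sumr_ge0 => i _; apply: ler0n.
rewrite mulr_suml /=.
apply: (@le_trans _ _ (\sum_(0 <= i < (n - k).+1) weight e * tree_weight n)); last first.
  rewrite big_const_nat iter_addr addr0 subn0 -mulrA -[leLHS]mulr_natl.
  by apply: ler_wpM2r => //; rewrite ler_nat; lia.
rewrite !big_nat; apply: ler_sum => i /andP[_ hi].
have -> : n = (i + (k + (n - k - i)))%N by lia.
set r := (n - k - i)%N.
have kD : (k <= D)%N by lia.
rewrite -(@tree_weightE D k) // -(@tree_weightE D (i + (k + r))); last by lia.
rewrite /forest_weight !word_sum_cat.
pose S := word_sum D i (fun u => word_sum D r (fun v =>
  (codes_forest (u ++ e ++ v) 1)%:R)).
have -> : word_sum D i (fun u => word_sum D (k + r) (fun v =>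
    (at_ i (u ++ v))%:R)) = weight e * S.
  rewrite /S mulrC -word_sumZr; apply: eq_word_sum => u su.
  rewrite word_sum_cat mulrC -(word_sum_delta _ (code_in_words he kD)).
  apply: eq_word_sum => w sw; case: eqP => [->|we].
    rewrite mul1r; apply: eq_word_sum => v _.
    by rewrite /at_ drop_size_cat // take_size_cat // eqxx andbT.
  rewrite mul0r /word_sum big1 // => v _.
  rewrite /at_ drop_size_cat // take_size_cat //.
  by move/eqP/negbTE: we => ->; rewrite andbF mulr0.
rewrite -mulrA; apply: ler_wpM2l; first exact: weight_ge0.
rewrite /S -word_sumZr; apply: ler_word_sum => u _.
rewrite word_sum_cat mulrC -word_sumZr; apply: ler_word_sum => w _.
case hw: (codes_forest w 1); rewrite ?mul0r ?mul1r.
  by apply: ler_word_sum => v _; rewrite (codes_forest_replace _ _ _ he hw).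
by apply: word_sum_ge0 => c; apply: ler0n.
Qed.

End WordSums.

(** * Critical offspring laws with finite variance *)

Section CriticalLaw.
Variables (R : realType) (p : nat -> R).

Record critical_law : Prop := CriticalLaw {
  law_ge0 : forall d, 0 <= p d;
  law_sum : \sum_(d < D) p d @[D --> \oo] --> (1 : R);
  law_mean : \sum_(d < D) d%:R * p d @[D --> \oo] --> (1 : R);
  law_var : exists V : R, forall D, \sum_(d < D) d%:R ^+ 2 * p d <= V;
  law_branching : exists2 d, (2 <= d)%N & 0 < p d
}.

Hypothesis law : critical_law.

Let p_ge0 := law_ge0 law.

Lemma partial_sum_le (u : nat -> R) (l : R) D : (forall d, 0 <= u d) ->
  \sum_(d < N) u d @[N --> \oo] --> l -> \sum_(d < D) u d <= l.
Proof.
move=> u0 ul; apply: (cvgr_to_ge ul); near=> N.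
rewrite -(big_mkord xpredT u) -(big_mkord xpredT u) (@big_cat_nat _ _ _ D 0 N) //=.
  by rewrite lerDl sumr_ge0.
by near: N; apply: nbhs_infty_ge.
Unshelve. all: by end_near. Qed.

Lemma law_sum_le1 D : \sum_(d < D) p d <= 1.
Proof. exact: partial_sum_le (law_sum law). Qed.

Lemma law_le1 d : p d <= 1.
Proof.
apply: le_trans (law_sum_le1 d.+1).
by rewrite big_ord_recr /= lerDr sumr_ge0.
Qed.

(** Were there no childless node, each node would have at least one child, and
    two or more with positive probability, so the mean would exceed 1. *)
Lemma law0_gt0 : 0 < p 0.
Proof.
have [d d2 pd] := law_branching law; apply: (lt_le_trans pd).
rewrite -subr_le0; have : \sum_(i < D) i%:R * p i - \sum_(i < D) p i
   @[D --> \oo] --> (1 - 1 : R) by apply: cvgB; [exact: law_mean|exact: law_sum].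
rewrite subrr => lim0; apply: (cvgr_to_ge lim0); near=> D.
have dD : (d < D)%N by near: D; apply: nbhs_infty_gt.
rewrite -sumrB (bigD1 (Ordinal dD)) //=.
have D0 : (0 < D)%N by lia.
rewrite (bigD1 (Ordinal D0)) /=; last first.
  by apply/eqP => /(congr1 val) /= dE; rewrite -dE in d2.
rewrite mul0r sub0r.
have dp : p d <= d%:R * p d - p d.
  have : 2%:R * p d <= d%:R * p d by rewrite ler_wpM2r ?ler_nat.
  lra.
suff : 0 <= \sum_(i < D | (i != Ordinal dD) && (i != Ordinal D0)) (i%:R * p i - p i).
  lra.
apply: sumr_ge0 => i /andP[_ i0]; rewrite subr_ge0 ler_peMl // ler1n lt0n.
by apply: contraNneq i0 => i0; apply/eqP/val_inj.
Unshelve. all: by end_near. Qed.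

Definition pgf (D : nat) (y : R) : R := \sum_(d < D) p d * y ^+ d.

(** Bounds of second order on [(1 - s) ^+ d] that are uniform in [d]; averaged
    over the offspring number they give the two bounds on [pgf]. *)
Lemma expr1B_le (s : R) d : 0 <= s <= 1 ->
  (1 - s) ^+ d <= 1 - s * d%:R + s ^+ 2 * d%:R ^+ 2.
Proof.
move=> /andP[s0 s1]; elim: d => [|d IH]; first by rewrite expr0; lra.
rewrite exprS; have h : (1 - s) * (1 - s) ^+ d <=
    (1 - s) * (1 - s * d%:R + s ^+ 2 * d%:R ^+ 2) by rewrite ler_wpM2l // subr_ge0.
apply: (le_trans h); rewrite -[d.+1]addn1 natrD.
set x : R := d%:R; have x0 : 0 <= x by apply: ler0n.
rewrite -subr_ge0 (_ : _ - _ = s ^+ 2 * (x + 1) + s ^+ 3 * x ^+ 2); last by ring.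
by rewrite addr_ge0 // mulr_ge0 ?exprn_ge0 ?addr_ge0.
Qed.

Lemma expr1B_ge (s : R) d : 0 <= s <= 1 -> 1 - s * d%:R <= (1 - s) ^+ d.
Proof.
move=> /andP[s0 s1]; elim: d => [|d IH]; first by rewrite expr0; lra.
rewrite exprS; have h : (1 - s) * (1 - s * d%:R) <= (1 - s) * (1 - s) ^+ d.
  by rewrite ler_wpM2l // subr_ge0.
apply: le_trans h; rewrite -[d.+1]addn1 natrD.
set x : R := d%:R; have x0 : 0 <= x by apply: ler0n.
rewrite -subr_ge0 (_ : _ - _ = s ^+ 2 * x); last by ring.
by rewrite mulr_ge0 ?exprn_ge0.
Qed.

Lemma expr1B_ge2 (s : R) d : 0 <= s <= 1 -> (2 <= d)%N ->
  1 - s * d%:R + s ^+ 2 <= (1 - s) ^+ d.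
Proof.
move=> s01 d2; have /andP[s0 s1] := s01.
rewrite -[d in (1 - s) ^+ d](subnKC d2) exprD.
have h : (1 - s) ^+ 2 * (1 - s * (d - 2)%:R) <= (1 - s) ^+ 2 * (1 - s) ^+ (d - 2).
  by rewrite ler_wpM2l ?expr1B_ge // exprn_ge0 ?subr_ge0.
apply: le_trans h; rewrite -[d in s * d%:R](subnKC d2) natrD.
set x : R := (d - 2)%:R; have x0 : 0 <= x by apply: ler0n.
rewrite -subr_ge0 (_ : _ - _ = s ^+ 2 * x * (1 + (1 - s))); last by ring.
by rewrite !mulr_ge0 ?exprn_ge0 // addr_ge0 // subr_ge0.
Qed.

Lemma pgf_le V D (s : R) : (forall D, \sum_(d < D) d%:R ^+ 2 * p d <= V) ->
  0 <= s <= 1 -> pgf D (1 - s) <= 1 - s + V * s ^+ 2.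
Proof.
move=> hV s01; have /andP[s0 s1] := s01.
have lim0 : \sum_(i < D) p i - s * \sum_(i < D) i%:R * p i + V * s ^+ 2
    @[D --> \oo] --> (1 - s * 1 + V * s ^+ 2 : R).
  apply: cvgD; last exact: cvg_cst.
  by apply: cvgB; [exact: law_sum|apply: cvgMr; exact: law_mean].
rewrite mulr1 in lim0; apply: (cvgr_to_ge lim0); near=> N.
have DN : (D <= N)%N by near: N; apply: nbhs_infty_ge.
apply: (@le_trans _ _ (pgf N (1 - s))).
  rewrite /pgf -!(big_mkord xpredT (fun d => p d * (1 - s) ^+ d)).
  rewrite (@big_cat_nat _ _ _ D 0 N) //= lerDl sumr_ge0 // => i _.
  by rewrite mulr_ge0 // exprn_ge0 // subr_ge0.
apply: (@le_trans _ _ (\sum_(d < N)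
   (p d - s * (d%:R * p d) + s ^+ 2 * (d%:R ^+ 2 * p d)))).
  apply: ler_sum => d _.
  have := ler_wpM2l (p_ge0 d) (expr1B_le d s01).
  by move/le_trans; apply; rewrite le_eqVlt; apply/orP; left; apply/eqP; ring.
rewrite big_split /= sumrB -!mulr_sumr lerD2l mulrC.
by apply: ler_wpM2r (hV N); apply: exprn_ge0.
Unshelve. all: by end_near. Qed.

Lemma pgf_ge d (s : R) (eta : R) : (2 <= d)%N -> 0 <= s <= 1 -> 0 < eta ->
  \forall D \near \oo, 1 - s + p d * s ^+ 2 - eta <= pgf D (1 - s).
Proof.
move=> d2 s01 eta0; have /andP[s0 s1] := s01.
have lim0 : \sum_(i < D) p i - s * \sum_(i < D) i%:R * p i + p d * s ^+ 2
    @[D --> \oo] --> (1 - s * 1 + p d * s ^+ 2 : R).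
  apply: cvgD; last exact: cvg_cst.
  by apply: cvgB; [exact: law_sum|apply: cvgMr; exact: law_mean].
rewrite mulr1 in lim0.
have lt_lim : 1 - s + p d * s ^+ 2 - eta < 1 - s + p d * s ^+ 2 by lra.
have near_lim := cvgr_ge _ lim0 _ lt_lim.
near=> D.
have dD : (d < D)%N by near: D; apply: nbhs_infty_gt.
apply: (@le_trans _ _ (\sum_(i < D) p i - s * \sum_(i < D) i%:R * p i + p d * s ^+ 2)).
  near: D. exact: near_lim.
rewrite /pgf mulr_sumr -sumrB (bigD1 (Ordinal dD)) //= [leRHS](bigD1 (Ordinal dD)) //=.
rewrite -addrAC lerD //.
  have := ler_wpM2l (p_ge0 d) (expr1B_ge2 s01 d2).
  by apply: le_trans; rewrite le_eqVlt; apply/orP; left; apply/eqP; ring.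
apply: ler_sum => i _.
have := ler_wpM2l (p_ge0 i) (expr1B_ge i s01).
by apply: le_trans; rewrite le_eqVlt; apply/orP; left; apply/eqP; ring.
Unshelve. all: by end_near. Qed.

(** ** The generating function of the tree size *)

Notation fw := (forest_weight p).
Notation tw := (tree_weight p).

(** Removing the first symbol of a code replaces one pending tree by [d] others,
    so by induction on [N] a supersolution [y] of [y = z * pgf y] gives the
    bound [y ^+ j] for [j] pending trees. *)
Lemma size_gf_le D (z y : R) N j : 0 <= z <= 1 -> 0 <= y <= 1 ->
  z * pgf D y <= y -> \sum_(n < N) fw D j n * z ^+ n <= y ^+ j.
Proof.
move=> /andP[z0 z1] /andP[y0 y1] hy; elim: N j => [|N IH] j.
  by rewrite big_ord0 exprn_ge0.
rewrite big_ord_recl /= forest_weightn0 expr0 mulr1.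
under eq_bigr do rewrite /bump /= add1n.
case: j => [|j].
  by rewrite big1 ?addr0 // => i _; rewrite forest_weight0S mul0r.
rewrite add0r; apply: (@le_trans _ _ (y ^+ j * (z * pgf D y))); last first.
  by rewrite exprSr ler_wpM2l ?exprn_ge0.
rewrite (_ : \sum_(i < N) _ = z * \sum_(d < D) p d * \sum_(i < N) fw D (j + d) i * z ^+ i).
  rewrite mulrCA ler_wpM2l // mulr_sumr; apply: ler_sum => d _.
  by rewrite mulrCA -exprD ler_wpM2l.
under [in RHS]eq_bigr do rewrite mulr_sumr.
rewrite exchange_big mulr_sumr; apply: eq_bigr => i _.
rewrite forest_weightSS mulr_suml mulr_sumr; apply: eq_bigr => d _.
by rewrite exprS; ring.
Qed.

(** For a subsolution the forests that are cut off at size [N] have to be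
    accounted for, whence the term [z ^+ N]. The error [eta] allows for the
    truncation of [pgf], and each of the [N] steps of the recursion costs it
    once. *)
Lemma size_gf_ge_approx D (z y eta : R) N j : 0 <= z <= 1 -> 0 <= y <= 1 ->
  0 <= eta -> y - eta <= z * pgf D y ->
  y ^+ j - z ^+ N - N%:R * eta <= \sum_(n < N.+1) fw D j n * z ^+ n.
Proof.
move=> /andP[z0 z1] /andP[y0 y1] eta0 hy; elim: N j => [|N IH] j.
  rewrite big_ord1 forest_weightn0 !expr0 mulr1 mul0r subr0.
  case: j => [|j] /=; first by rewrite expr0 subrr.
  by rewrite subr_le0 exprn_ile1.
rewrite big_ord_recl /= forest_weightn0 expr0 mulr1.
under eq_bigr do rewrite /bump /= add1n.
case: j => [|j].
  rewrite big1 ?addr0 => [|i _]; last by rewrite forest_weight0S mul0r.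
  rewrite expr0 -addrA gerDl -opprD oppr_le0.
  by rewrite addr_ge0 ?exprn_ge0 ?mulr_ge0.
rewrite add0r (_ : \sum_(i < N.+1) _ =
   z * \sum_(d < D) p d * \sum_(i < N.+1) fw D (j + d) i * z ^+ i); last first.
  under [in RHS]eq_bigr do rewrite mulr_sumr.
  rewrite exchange_big mulr_sumr; apply: eq_bigr => i _.
  rewrite forest_weightSS mulr_suml mulr_sumr; apply: eq_bigr => d _.
  by rewrite exprS; ring.
set S := \sum_(d < D) _.
have hS : y ^+ j * pgf D y - (z ^+ N + N%:R * eta) <= S.
  apply: (@le_trans _ _ (\sum_(d < D) p d * (y ^+ (j + d) - z ^+ N - N%:R * eta))).
    under [leRHS]eq_bigr do rewrite -addrA -opprD mulrBr exprD mulrCA.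
    rewrite sumrB -mulr_sumr -mulr_suml lerD2l lerN2.
    by rewrite ler_piMl ?law_sum_le1 // addr_ge0 ?exprn_ge0 ?mulr_ge0.
  by apply: ler_sum => d _; rewrite ler_wpM2l.
apply: (@le_trans _ _ (z * (y ^+ j * pgf D y - (z ^+ N + N%:R * eta)))); last first.
  by rewrite ler_wpM2l.
have h1 : y ^+ j * (y - eta) <= y ^+ j * (z * pgf D y).
  by rewrite ler_wpM2l ?exprn_ge0.
have h2 : y ^+ j * eta <= eta by rewrite ler_piMl // exprn_ile1.
have h3 : z * (N%:R * eta) <= N%:R * eta by rewrite ler_piMl ?mulr_ge0.
rewrite -[N.+1]addn1 natrD !addn1 !exprS.
have -> : z * (y ^+ j * pgf D y - (z ^+ N + N%:R * eta)) =
  y ^+ j * (z * pgf D y) - z * z ^+ N - z * (N%:R * eta) by ring.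
move: h1; rewrite mulrBr [y * y ^+ j]mulrC; lra.
Qed.

Lemma size_gf_tree D N (z : R) : (N <= D)%N ->
  \sum_(n < N.+1) fw D 1 n * z ^+ n = \sum_(n < N.+1) tw n * z ^+ n.
Proof.
move=> ND; apply: eq_bigr => n _.
by rewrite (@tree_weightE _ p D) // (leq_trans _ ND) // -ltnS.
Qed.

(** The point [1 - s] is a supersolution at [z = 1 - 2 * V * s ^+ 2]. In the next
    lemma it is a subsolution at [z = 1 - p d * s ^+ 2]. Together these say that
    [1 - T (1 - eps)] is of order [sqrt eps], where [T] is the generating
    function of the tree size. *)
Lemma tree_gf_le V N (s : R) : (forall D, \sum_(d < D) d%:R ^+ 2 * p d <= V) ->
  0 <= V -> 0 <= s <= 2^-1 -> 2 * V * s ^+ 2 <= 1 ->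
  \sum_(n < N.+1) tw n * (1 - 2 * V * s ^+ 2) ^+ n <= 1 - s.
Proof.
move=> hV V0 /andP[s0 s1] hs.
have Vs0 : 0 <= V * s ^+ 2 by rewrite mulr_ge0 ?exprn_ge0.
have s01 : 0 <= s <= 1 by apply/andP; split; lra.
rewrite -(@size_gf_tree N) // -[leRHS]expr1; apply: size_gf_le; try lra.
have h := pgf_le N hV s01.
apply: (@le_trans _ _ ((1 - 2 * V * s ^+ 2) * (1 - s + V * s ^+ 2))).
  by rewrite ler_wpM2l // subr_ge0.
rewrite -subr_ge0 (_ : _ - _ = (V * s ^+ 2) * (1 - 2 * s + 2 * (V * s ^+ 2))); last by ring.
by rewrite mulr_ge0 //; lra.
Qed.

Lemma tree_gf_ge d N (s : R) : (2 <= d)%N -> 0 <= s <= 1 ->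
  1 - s - (1 - p d * s ^+ 2) ^+ N <=
  \sum_(n < N.+1) tw n * (1 - p d * s ^+ 2) ^+ n.
Proof.
move=> d2 s01; have /andP[s0 s1] := s01.
have s2 : s ^+ 2 <= 1 by rewrite exprn_ile1.
have q1 : p d * s ^+ 2 <= 1.
  by apply: mulr_ile1 => //; [exact: exprn_ge0|exact: law_le1].
have q0 : 0 <= p d * s ^+ 2 by rewrite mulr_ge0 ?exprn_ge0.
apply/ler_addgt0Pr => e e0.
have N0 : 0 < N%:R + 1 :> R by rewrite ltr_pwDr.
pose eta := e / (N%:R + 1).
have eta0 : 0 < eta by rewrite divr_gt0.
near \oo => D.
have ND : (N <= D)%N by near: D; apply: nbhs_infty_ge.
have hD : 1 - s + p d * s ^+ 2 - eta <= pgf D (1 - s).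
  by near: D; apply: pgf_ge.
rewrite -(@size_gf_tree D) //.
have : (1 - s) ^+ 1 - (1 - p d * s ^+ 2) ^+ N - N%:R * eta <=
   \sum_(n < N.+1) fw D 1 n * (1 - p d * s ^+ 2) ^+ n.
  apply: size_gf_ge_approx; try lra.
  apply: (@le_trans _ _ ((1 - p d * s ^+ 2) * (1 - s + p d * s ^+ 2 - eta))); last first.
    by rewrite ler_wpM2l // subr_ge0.
  rewrite -subr_ge0 (_ : _ - _ = (p d * s ^+ 2) * (s - p d * s ^+ 2 + eta)); last by ring.
  rewrite mulr_ge0 // addr_ge0 ?(ltW eta0) // subr_ge0 expr2 mulrA.
  rewrite ler_piMl //; apply: mulr_ile1 => //; exact: law_le1.
have : N%:R * eta <= e.
  by rewrite /eta mulrA ler_pdivrMr // mulrC ler_wpM2l ?(ltW e0) // lerDl.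
rewrite expr1; lra.
Unshelve. all: by end_near. Qed.

End CriticalLaw.

(** * A lower bound for the probability of a given tree size *)

Section TreeSize.
Variables (R : realType) (p : nat -> R).
Hypothesis law : critical_law p.
Let p_ge0 := law_ge0 law.
Notation tw := (tree_weight p).

Let tw_ge0 n : 0 <= tw n. Proof. exact: tree_weight_ge0. Qed.

Lemma expr1B_bernoulli (x : R) n : 0 <= x <= 1 ->
  (1 - x) ^+ n * (1 + n%:R * x) <= 1.
Proof.
move=> /andP[x0 x1]; elim: n => [|n IH]; first by rewrite expr0; lra.
apply: le_trans IH; rewrite exprSr -mulrA ler_wpM2l ?exprn_ge0 ?subr_ge0 //.
rewrite -[n.+1]addn1 natrD -subr_ge0.
rewrite (_ : _ - _ = x ^+ 2 * (n%:R + 1)); last by ring.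
by rewrite mulr_ge0 ?exprn_ge0 // addr_ge0.
Qed.

Lemma tree_weight_sum_le1 N : \sum_(n < N) tw n <= 1.
Proof.
case: N => [|N]; first by rewrite big_ord0.
have [V hV] := law_var law.
have := @tree_gf_le _ _ law (Num.max V 0) N 0.
rewrite expr0n /= mulr0 subr0.
under eq_bigr do rewrite expr1n mulr1.
apply; rewrite ?le_max ?lexx ?orbT //; try lra.
by move=> D; rewrite le_max hV.
Qed.

(** [1 - sum tw n * z ^ n] collects what is lost by the weights [z ^ n]; sizes
    beyond [x], including infinite trees, lose at least [1 - z ^+ x]. *)
Lemma tree_defect_tail x N (z : R) : 0 <= z <= 1 -> (x <= N)%N ->
  (1 - \sum_(n < x.+1) tw n) * (1 - z ^+ x) +
    \sum_(n < x.+1) tw n * (1 - z ^+ n) <= 1 - \sum_(n < N.+1) tw n * z ^+ n.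
Proof.
move=> /andP[z0 z1] xN.
have split_sum (F : nat -> R) : \sum_(n < N.+1) F n =
    \sum_(n < x.+1) F n + \sum_(x.+1 <= n < N.+1) F n.
  by rewrite -!(big_mkord xpredT F) (@big_cat_nat _ _ _ x.+1).
rewrite (split_sum (fun n => tw n * z ^+ n)).
have -> : \sum_(n < x.+1) tw n * (1 - z ^+ n) =
    \sum_(n < x.+1) tw n - \sum_(n < x.+1) tw n * z ^+ n.
  by rewrite -sumrB; apply: eq_bigr => n _; rewrite mulrBr mulr1.
have h1 : \sum_(x.+1 <= n < N.+1) tw n * z ^+ n <=
    (\sum_(x.+1 <= n < N.+1) tw n) * z ^+ x.
  rewrite mulr_suml !big_nat; apply: ler_sum => n /andP[xn _].
  by rewrite ler_wpM2l // ler_wiXn2l // ltnW.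
have h2 := tree_weight_sum_le1 N.+1; rewrite split_sum in h2.
have h3 : (\sum_(n < x.+1) tw n + \sum_(x.+1 <= n < N.+1) tw n) * z ^+ x <= z ^+ x.
  by rewrite ler_piMl // exprn_ge0.
move: h1 h3; set A := \sum_(n < x.+1) tw n; nra.
Qed.

Lemma tree_defect_le d x (s : R) : (2 <= d)%N -> 0 < p d -> 0 < s <= 1 ->
  (1 - \sum_(n < x.+1) tw n) * (1 - (1 - p d * s ^+ 2) ^+ x) +
    \sum_(n < x.+1) tw n * (1 - (1 - p d * s ^+ 2) ^+ n) <= s.
Proof.
move=> d2 pd /andP[s0 s1]; set z := 1 - p d * s ^+ 2.
have q0 : 0 < p d * s ^+ 2 by rewrite mulr_gt0 ?exprn_gt0.
have q1 : p d * s ^+ 2 <= 1.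
  apply: mulr_ile1; rewrite ?exprn_ge0 ?(ltW s0) ?exprn_ile1 ?(ltW s0) //.
  exact: law_le1.
have z01 : 0 <= z <= 1 by rewrite /z; lra.
have z1 : `|z| < 1 by rewrite ger0_norm; rewrite /z; lra.
have zlim := cvg_expr z1.
have lim0 : s + z ^+ N @[N --> \oo] --> s + 0 by apply: cvgD => //; exact: cvg_cst.
rewrite addr0 in lim0; apply: (cvgr_to_ge lim0); near=> N.
have xN : (x <= N)%N by near: N; apply: nbhs_infty_ge.
have := tree_defect_tail z01 xN; move/le_trans; apply.
have s01 : 0 <= s <= 1 by lra.
have := @tree_gf_ge _ _ law d N s d2 s01; rewrite -/z; lra.
Unshelve. all: by end_near. Qed.

Lemma inv_sqrt_spec (q : R) x : 0 < q -> (0 < x)%N -> 1 <= q * x%:R ->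
  exists2 s : R, 0 < s <= 1 & q * s ^+ 2 * x%:R = 1.
Proof.
move=> q0 x0 qx; have x0' : 0 < x%:R :> R by rewrite ltr0n.
have qx0 : 0 < q * x%:R by rewrite mulr_gt0.
exists (Num.sqrt (q * x%:R))^-1.
  rewrite invr_gt0 sqrtr_gt0 qx0 /= invf_le1 ?sqrtr_gt0 //.
  by rewrite -[leLHS]sqrtr1 ler_sqrt ?(ltW qx0).
rewrite exprVn sqr_sqrtr ?(ltW qx0) //; field.
by rewrite gt_eqF //= gt_eqF.
Qed.

(** With [q * s ^+ 2 = 1 / x], so that [s] is of order [1 / sqrt x], both the
    tail beyond [x] and the truncated mean are controlled. *)
Lemma tree_tail_le d x (s : R) : (2 <= d)%N -> 0 < p d -> (0 < x)%N ->
  0 < s <= 1 -> p d * s ^+ 2 * x%:R = 1 ->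
  1 - \sum_(n < x.+1) tw n <= 2 * s /\
  \sum_(n < x.+1) tw n * n%:R <= 2 * s * x%:R.
Proof.
move=> d2 pd x0 s01 hx; have /andP[s0 s1] := s01.
have x0' : 0 < x%:R :> R by rewrite ltr0n.
have := @tree_defect_le d x s d2 pd s01; set z := p d * s ^+ 2 => hd.
have zE : z = x%:R^-1 by apply: (mulIf (lt0r_neq0 x0')); rewrite mulVf ?gt_eqF.
have z01 : 0 <= z <= 1.
  by rewrite zE invr_ge0 ler0n invf_le1 // ler1n.
have Q0 : 0 <= 1 - \sum_(n < x.+1) tw n by rewrite subr_ge0 tree_weight_sum_le1.
have A0 : 0 <= \sum_(n < x.+1) tw n * (1 - (1 - z) ^+ n).
  apply: sumr_ge0 => n _; rewrite mulr_ge0 // subr_ge0 exprn_ile1 //; lra.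
have half : 2^-1 <= 1 - (1 - z) ^+ x.
  have := expr1B_bernoulli x z01; rewrite mulrC [_ * z]mulrC hx; lra.
split.
  have : (1 - \sum_(n < x.+1) tw n) * 2^-1 <=
    (1 - \sum_(n < x.+1) tw n) * (1 - (1 - z) ^+ x) by rewrite ler_wpM2l.
  lra.
have h : \sum_(n < x.+1) tw n * n%:R <=
    2 * x%:R * \sum_(n < x.+1) tw n * (1 - (1 - z) ^+ n).
  rewrite mulr_sumr; apply: ler_sum => n _; rewrite mulrCA ler_wpM2l //.
  have nx : n%:R <= x%:R :> R by rewrite ler_nat -ltnS.
  have n0 : 0 <= n%:R :> R by apply: ler0n.
  have nz1 : n%:R * z <= 1 by rewrite zE ler_pdivrMr // mul1r.
  have nz0 : 0 <= n%:R * z by rewrite zE divr_ge0.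
  have b := expr1B_bernoulli n z01.
  have y1 : (1 - z) ^+ n <= 1 by rewrite exprn_ile1 //; lra.
  set y := (1 - z) ^+ n in b y1 *.
  have : n%:R * z <= 2 * (1 - y).
    have y0 : 0 <= y by rewrite exprn_ge0 //; lra.
    nra.
  move=> hh; have := ler_wpM2r (ltW x0') hh.
  by rewrite -[n%:R * z * _]mulrA hx mulr1 mulrAC.
have Qz0 : 0 <= (1 - \sum_(n < x.+1) tw n) * (1 - (1 - z) ^+ x).
  by rewrite mulr_ge0 //; lra.
apply: (le_trans h); rewrite mulrAC; apply: ler_wpM2r; first exact: ltW.
lra.
Qed.

(** At every scale there is a tree size whose probability is not smaller than
    a power of that scale. If the window carried too little mass, then the
    defect at the intermediate scale [s / B] would come from the tail and from
    the truncated mean only, and both are too small there. *)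
Lemma tree_weight_window : exists L K X0 : nat, [/\ (0 < L)%N, (0 < K)%N &
  forall x, (X0 <= x)%N -> (0 < x)%N -> exists2 n, (x < n <= L * x)%N &
    1 <= tw n * (K * x ^ 2)%:R].
Proof.
have [d d2 pd] := law_branching law; have [V0 hV0] := law_var law.
pose V := Num.max V0 1.
have hV D : \sum_(d < D) d%:R ^+ 2 * p d <= V by rewrite le_max hV0.
have V1 : 1 <= V by rewrite le_max lexx orbT.
set q := p d in pd; have q1 : q <= 1 by apply: law_le1.
pose B := (Num.truncn (16 * V / q)).+2.
have hB : 16 * V / q <= B%:R.
  apply: ltW; apply: lt_le_trans (truncnS_gt _) _.
  by rewrite ler_nat.
have B0 : 0 < B%:R :> R by rewrite ltr0n.
have Vq : V <= V / q by rewrite ler_pdivlMr // ler_piMr //; lra.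
have B2 : 2 <= B%:R :> R by rewrite ler_nat.
have BV : 2 * V <= B%:R by lra.
pose L := (64 * B ^ 2)%N; pose X0 := (Num.truncn q^-1).+1.
have L0 : (0 < L)%N by rewrite muln_gt0 expn_gt0.
exists L, (2 * B * L)%N, X0; split=> //.
move=> x X0x x0; have x0' : 0 < x%:R :> R by rewrite ltr0n.
have qx : 1 <= q * x%:R.
  rewrite mulrC -ler_pdivrMr // div1r; apply: ltW.
  by apply: lt_le_trans (truncnS_gt _) _; rewrite ler_nat.
have [s s01 hs] := inv_sqrt_spec pd x0 qx; have /andP[s0 s1] := s01.
have [_ hA] := tree_tail_le d2 pd x0 s01 hs.
have Lx0 : (0 < L * x)%N by rewrite muln_gt0 L0.
have B8 : 0 < 8 * B%:R :> R by rewrite mulr_gt0.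
have s01' : 0 < s / (8 * B%:R) <= 1.
  rewrite divr_gt0 //= ler_pdivrMr // mul1r; lra.
have hs' : p d * (s / (8 * B%:R)) ^+ 2 * (L * x)%:R = 1.
  rewrite -[RHS]hs /L !natrM -/q; field.
  by rewrite gt_eqF.
have [hQ _] := tree_tail_le d2 pd Lx0 s01' hs'.
set Q := 1 - _ in hQ; set A := \sum_(n < x.+1) _ in hA.
(* At this scale, [eps * x] is of order [1 / B ^ 2], so the truncated mean
   contributes at most [s' / 4]; the tail beyond [L * x], with
   [L = 64 * B ^ 2], also contributes at most [s' / 4]. *)
pose s' := s / B%:R; pose eps := 2 * V * s' ^+ 2.
have s'0 : 0 < s' by rewrite divr_gt0.
have s'2 : s' <= 2^-1 by rewrite /s' ler_pdivrMr //; lra.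
have s'1 : 0 <= s' <= 2^-1 by rewrite (ltW s'0).
have eps1 : eps <= 1.
  rewrite /eps expr2 mulrA; apply: mulr_ile1; try lra.
    by rewrite mulr_ge0 // ?mulr_ge0 //; lra.
  by rewrite /s' mulrA ler_pdivrMr // mul1r; nra.
have eps0 : 0 <= eps by rewrite /eps mulr_ge0 ?exprn_ge0 //; lra.
have hgf := @tree_gf_le _ _ law V (L * x) s' hV (le_trans ler01 V1) s'1 eps1.
rewrite -/eps in hgf.
pose M := \sum_(x.+1 <= n < (L * x).+1) tw n.
have Lx : (x <= L * x)%N by rewrite leq_pmull.
have split_sum (F : nat -> R) : \sum_(n < (L * x).+1) F n =
    \sum_(n < x.+1) F n + \sum_(x.+1 <= n < (L * x).+1) F n.
  by rewrite -!(big_mkord xpredT F) (@big_cat_nat _ _ _ x.+1).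
have hdef : s' <= Q + eps * A + M.
  have zn n : 1 - (1 - eps) ^+ n <= n%:R * eps.
    by have := @expr1B_ge _ eps n; rewrite eps0 eps1 => /(_ isT); lra.
  have : \sum_(n < (L * x).+1) tw n - \sum_(n < (L * x).+1) tw n * (1 - eps) ^+ n
      <= eps * A + M.
    rewrite -sumrB (split_sum (fun n => tw n - tw n * (1 - eps) ^+ n)).
    apply: lerD.
      rewrite mulr_sumr; apply: ler_sum => n _.
      rewrite mulrCA [eps * _]mulrC.
      have := ler_wpM2l (tw_ge0 n) (zn n); rewrite mulrBr mulr1; lra.
    apply: ler_sum => n _; rewrite lerBlDl lerDr mulr_ge0 // exprn_ge0 //; lra.
  rewrite /Q; lra.
have hepsA : eps * A <= s' / 4.
  apply: (@le_trans _ _ (eps * (2 * s * x%:R))); first by rewrite ler_wpM2l.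
  have -> : eps * (2 * s * x%:R) = s' * (4 * V * (s ^+ 2 * x%:R) / B%:R).
    rewrite /eps /s'; field; lra.
  have -> : s ^+ 2 * x%:R = q^-1.
    by apply: (mulfI (lt0r_neq0 pd)); rewrite mulrA hs divff // gt_eqF.
  rewrite ler_wpM2l ?(ltW s'0) // ler_pdivrMr //.
  have -> : 4 * V / q = 16 * V / q / 4 by field; rewrite gt_eqF.
  lra.
have hM : s' / 2 <= M.
  have : 2 * (s / (8 * B%:R)) = s' / 4 by rewrite /s'; field; rewrite gt_eqF.
  lra.
have sx : 1 <= s * x%:R.
  have h1 : 1 <= (s * x%:R) ^+ 2.
    have : q * s ^+ 2 * x%:R * x%:R = x%:R by rewrite hs mul1r.
    have x1 : 1 <= x%:R :> R by rewrite ler1n.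
    have sx0 : 0 <= (s * x%:R) ^+ 2 by rewrite exprn_ge0 // mulr_ge0 ?(ltW s0).
    have := ler_wpM2r sx0 q1; rewrite mul1r.
    have -> : q * s ^+ 2 * x%:R * x%:R = q * (s * x%:R) ^+ 2 by ring.
    lra.
  have sx0 : 0 <= s * x%:R by rewrite mulr_ge0 // ltW.
  by move: h1; rewrite -[X in X <= _](expr1n _ 2) ler_sqr ?nnegrE.
apply: contrapT => no.
have small n : (x < n <= L * x)%N -> tw n * (2 * B * L * x ^ 2)%:R < 1.
  by move=> hn; rewrite ltNge; apply/negP => hn'; apply: no; exists n.
have : M * (2 * B * L * x ^ 2)%:R < (L * x)%:R.
  have -> : (L * x)%:R = \sum_(1 <= n < (L * x).+1) (1 : R).
    by rewrite sumr_const_nat subn1.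
  rewrite (@big_cat_nat _ _ _ x.+1) //= /M mulr_suml.
  have : 0 < \sum_(1 <= n < x.+1) (1 : R) by rewrite sumr_const_nat subn1 ltr0n.
  have : \sum_(x.+1 <= n < (L * x).+1) tw n * (2 * B * L * x ^ 2)%:R <=
    \sum_(x.+1 <= n < (L * x).+1) 1.
    rewrite !big_nat; apply: ler_sum => n hn; apply: ltW; apply: small.
    by move: hn; rewrite !ltnS.
  lra.
apply/negP; rewrite -leNgt.
apply: (@le_trans _ _ (s' / 2 * (2 * B * L * x ^ 2)%:R)); last first.
  by rewrite ler_wpM2r.
have -> : s' / 2 * (2 * B * L * x ^ 2)%:R = (L * x)%:R * (s * x%:R).
  rewrite /s' !natrM; field; lra.
by rewrite ler_peMr.
Qed.

End TreeSize.

(** The period is the least positive difference of two elements; it divides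
    every element by Euclidean division, and two elements that differ by it
    generate all large multiples. *)
Lemma additive_set_period (S : nat -> bool) (m : nat) :
  (forall a b, S a -> S b -> S (a + b)%N) -> S 0%N -> (0 < m)%N -> S m ->
  exists g n0 : nat, [/\ (0 < g)%N, (forall n, S n -> (g %| n)%N) &
    forall n, (n0 <= n)%N -> (g %| n)%N -> S n].
Proof.
move=> Sadd S0 m0 Sm.
have Smul k a : S a -> S (k * a)%N.
  by move=> Sa; elim: k => [|k IH]; rewrite ?mul0n // mulSn; apply: Sadd.
pose diff g := `[< (0 < g)%N /\ exists s, S s /\ S (s + g)%N >].
have ex_diff : exists g, diff g by exists m; apply/asboolP; split=> //; exists 0%N.
have [g /asboolP[g0 [s [Ss Ssg]]] gmin] := ex_minnP ex_diff.
have gdvd n : S n -> (g %| n)%N.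
  move=> Sn; rewrite /dvdn; apply: contraT; rewrite -lt0n => r0.
  have : diff (n %% g)%N.
    apply/asboolP; split=> //; exists ((n %/ g) * (s + g))%N; split; first exact: Smul.
    have -> : ((n %/ g) * (s + g) + n %% g = (n %/ g) * s + n)%N.
      by rewrite mulnDr -addnA -divn_eq.
    by apply: Sadd => //; apply: Smul.
  by move/gmin; rewrite leqNgt ltn_mod g0.
exists g, (s * s)%N; split=> // n sn /dvdnP[q nq].
have [s' sE] := dvdnP (gdvd s Ss).
have [s0|s0] := posnP s'.
  have -> : n = (q * (s + g))%N by rewrite sE s0 mul0n add0n.
  exact: Smul.
have qs : (q %% s' <= q %/ s')%N.
  apply: (@leq_trans s'); first by rewrite ltnW // ltn_mod.
  rewrite leq_divRL //; move: sn; rewrite nq sE => sn.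
  have : (s' * s' * g <= q)%N by nia.
  nia.
have -> : n = ((q %/ s' - q %% s') * s + (q %% s') * (s + g))%N.
  rewrite mulnDr addnA -mulnDl subnK // sE mulnA -mulnDl -divn_eq //.
by apply: Sadd; apply: Smul.
Qed.

Section TreeSizeBound.
Variables (R : realType) (p : nat -> R).
Hypothesis law : critical_law p.
Let p_ge0 := law_ge0 law.
Notation tw := (tree_weight p).

Lemma tree_weight_star d : 0 < p d -> 0 < tw d.+1.
Proof.
move=> pd; have leaves j : codes_forest (nseq j 0%N) j.
  by elim: j => //= j; rewrite addn0.
have he : codes_forest (d :: nseq d 0%N) 1 by rewrite /= add0n.
have := weight_le_tree_weight p_ge0 he; rewrite /= size_nseq.
apply: lt_le_trans; rewrite /weight big_cons mulr_gt0 // big_seq prodr_gt0 // => i.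
by rewrite mem_nseq => /andP[_ /eqP ->]; apply: law0_gt0 law.
Qed.

(** The sizes of trees, less one, are closed under addition by grafting, and they
    contain the offspring numbers because of the stars. *)
Lemma tree_weight_period h :
  (forall g, (forall i, (0 < i)%N -> 0 < p i -> (g %| i)%N) -> (g %| h)%N) ->
  exists g n0 : nat, [/\ (g %| h)%N, (forall n, 0 < tw n.+1 -> (g %| n)%N) &
    forall n, (n0 <= n)%N -> (g %| n)%N -> 0 < tw n.+1].
Proof.
move=> hh; have [d d2 pd] := law_branching law.
have [||||g [n0 [g0 gdvd gbig]]] :=
  @additive_set_period (fun n => 0 < tw n.+1) d.
- move=> a b ha hb; apply: lt_le_trans (tree_weight_graft p_ge0 (law_sum_le1 law) a b).
  exact: mulr_gt0.
- exact: tree_weight_star (law0_gt0 law).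
- by rewrite (leq_trans _ d2).
- exact: tree_weight_star.
exists g, n0; split=> //; apply: hh => i _ pi; apply: gdvd.
exact: tree_weight_star.
Qed.

(** Removing a fixed proportion from [x] lowers [(ln x) ^ 2] by a multiple of
    [ln x]; this pays for one splitting in tree_weight_ge. *)
Lemma ln_sqr_gap (x y : R) : 1 <= y -> y <= x ->
  (x - y) / x * ln x <= ln x ^+ 2 - ln y ^+ 2.
Proof.
move=> y1 yx; have x0 : 0 < x by lra.
have y0 : 0 < y by lra.
have lny : 0 <= ln y by apply: ln_ge0.
have lnx : 0 <= ln x by apply: ln_ge0; lra.
have gap : (x - y) / x <= ln x - ln y.
  have h := @le_ln1Dx R (y / x - 1).
  rewrite addrCA subrr addr0 ln_div ?posrE // in h.
  have : -1 < y / x - 1 by rewrite ltrBrDr addNr divr_gt0.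
  by move/h; rewrite mulrBl divff ?gt_eqF //; lra.
apply: (@le_trans _ _ ((ln x - ln y) * ln x)); first by rewrite ler_wpM2r.
have : 0 <= (ln x - ln y) * ln y.
  rewrite mulr_ge0 // subr_ge0 ler_ln ?posrE //.
nra.
Qed.

Lemma divn_scale n L M : (0 < L)%N -> (4 * L * M.+1 <= n)%N ->
  [/\ (M < n %/ (2 * L))%N, (2 * L * (n %/ (2 * L)) <= n)%N &
      (n < 4 * L * (n %/ (2 * L)))%N].
Proof.
move=> L0 hn; have L2 : (0 < 2 * L)%N by rewrite muln_gt0.
have hx : (M < n %/ (2 * L))%N.
  by rewrite leq_divRL //; apply: leq_trans hn; nia.
split=> //; first by rewrite mulnC leq_trunc_div.
by apply: (leq_trans (ltn_ceil n L2)); nia.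
Qed.

(** Probabilities of tree sizes are supermultiplicative up to a shift, so a
    size can be split off at each scale, at a cost polynomial in the size; a
    logarithmic number of splittings suffices. *)
Lemma tree_weight_ge : exists2 C : R, 0 < C &
  forall n, 0 < tw n.+1 -> expR (- C * (1 + ln n.+1%:R ^+ 2)) <= tw n.+1.
Proof.
have [g [n0 [_ gdvd gbig]]] := @tree_weight_period 0 (fun g _ => dvdn0 g).
have [L [K [X0 [L0 K0 window]]]] := tree_weight_window law.
pose N1 := (2 * n0 + 4 * L * X0.+1 + K)%N.
have [c c0 hc] : exists2 c : R, 0 < c <= 1 &
    forall n, (n < N1)%N -> 0 < tw n.+1 -> c <= tw n.+1.
  elim: {1}N1 => [|N [c /andP[c0 c1] hc]]; first by exists 1; rewrite ?ltr01 ?lexx.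
  case: (ltrP 0 (tw N.+1)) => [tN|tN].
    exists (Num.min c (tw N.+1)); first by rewrite lt_min c0 tN ge_min c1.
    move=> n; rewrite ltnS leq_eqVlt => /orP[/eqP ->|nN] tn.
      by rewrite ge_min lexx orbT.
    by rewrite ge_min hc.
  exists c; first by rewrite c0.
  move=> n; rewrite ltnS leq_eqVlt => /orP[/eqP ->|nN] tn; last exact: hc.
  by move: tn; rewrite ltNge tN.
have /andP[cgt0 cle1] := c0.
pose C : R := 12 * L%:R.
have L0' : 0 < L%:R :> R by rewrite ltr0n.
have main n : 0 < tw n.+1 -> c * expR (- C * ln n.+1%:R ^+ 2) <= tw n.+1.
  elim/ltn_ind: n => n IH tn.
  have [nN|nN] := ltnP n N1.
    apply: le_trans (hc n nN tn); rewrite ler_piMr ?(ltW cgt0) //.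
    rewrite -expR0 ler_expR mulNr oppr_le0 mulr_ge0 ?sqr_ge0 //.
    by rewrite mulr_ge0 // ltW.
  have [n0n Ln Kn] : [/\ (2 * n0 <= n)%N, (4 * L * X0.+1 <= n)%N & (K <= n)%N].
    by clear -nN; rewrite /N1 in nN; split; lia.
  have [xX x2 x4] := divn_scale L0 Ln; set x := (n %/ (2 * L))%N in xX x2 x4.
  have [k /andP[xk kL] hk] := window x (ltnW xX) (leq_ltn_trans (leq0n _) xX).
  have k0 : (0 < k)%N by apply: leq_ltn_trans xk.
  pose k' := k.-1; have kE : k = k'.+1 by rewrite prednK.
  have tk : 0 < tw k'.+1.
    rewrite -kE lt_neqAle eq_sym (tree_weight_ge0 p_ge0) andbT.
    by apply: contraTneq hk => ->; rewrite mul0r -ltNge ltr01.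
  have kn : (2 * k' < n)%N.
    by clear -x2 kL kE k0 L0; rewrite kE in kL; nia.
  pose r := (n - k')%N.
  have [k'n rn0 rn rn'] : [/\ (k' <= n)%N, (n0 <= r)%N, (r < n)%N & (r <= n)%N].
    by clear -kn n0n kE xk xX; rewrite /r; split; lia.
  have rE : n = (k' + r)%N by rewrite subnKC.
  have tr : 0 < tw r.+1.
    by apply: gbig => //; rewrite dvdn_subr ?gdvd.
  have hr := IH r rn tr.
  have := tree_weight_graft p_ge0 (law_sum_le1 law) k' r; rewrite -rE.
  apply: le_trans.
  (* splitting off [k'] costs at most a factor [n.+1 ^ 3] *)
  have hk' : expR (- 3 * ln n.+1%:R) <= tw k'.+1.
    have n1 : 0 < n.+1%:R :> R by rewrite ltr0n.
    have -> : expR (- 3 * ln n.+1%:R) = (n.+1%:R ^+ 3)^-1 :> R.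
      rewrite mulNr expRN [3 * _]mulrC expRM_natr lnK ?posrE //.
    rewrite -[leLHS]mul1r ler_pdivrMr ?exprn_gt0 //.
    rewrite -kE in tk *; apply: (le_trans hk); rewrite ler_wpM2l ?(ltW tk) //.
    rewrite -natrX ler_nat !expnS expn0 !muln1.
    have x1 : (x <= n.+1)%N by apply/leqW/leq_div.
    by apply: leq_mul; [exact: leqW|apply: leq_mul].
  apply: (@le_trans _ _ (expR (- 3 * ln n.+1%:R) * (c * expR (- C * ln r.+1%:R ^+ 2)))); last first.
    by apply: ler_pM => //; rewrite ?expR_ge0 // mulr_ge0 ?expR_ge0 // ltW.
  rewrite [leRHS]mulrCA ler_wpM2l ?(ltW cgt0) // -expRD ler_expR.
  have r1 : 1 <= r.+1%:R :> R by rewrite ler1n.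
  have rnR : r.+1%:R <= n.+1%:R :> R by rewrite ler_nat ltnS.
  have gap := ln_sqr_gap r1 rnR.
  have lnn : 0 <= ln n.+1%:R :> R by apply: ln_ge0; rewrite ler1n.
  have n1 : 0 < n.+1%:R :> R by rewrite ltr0n.
  have frac : 4^-1 / L%:R <= (n.+1%:R - r.+1%:R) / n.+1%:R :> R.
    rewrite -natrB; last by rewrite ltnS.
    rewrite ler_pdivlMr // mulrAC ler_pdivrMr // mulrC ler_pdivrMr //.
    rewrite -!natrM ler_nat subSS subKn //; apply: (leq_trans x4).
    by clear -xk kE; rewrite kE in xk; nia.
  have frac' : 3 <= C * ((n.+1%:R - r.+1%:R) / n.+1%:R).
    have -> : 3 = C * (4^-1 / L%:R) :> R by rewrite /C; field; rewrite gt_eqF.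
    by rewrite ler_wpM2l // mulr_ge0 // ltW.
  have := ler_wpM2r lnn frac'; rewrite -mulrA.
  have C0 : 0 <= C by rewrite mulr_ge0 // ltW.
  have gapC := ler_wpM2l C0 gap; move: gapC; rewrite mulrBr mulrA.
  clear; set a := ln _; set b := ln _ ^+ 2; set q := _ * a; set y := a ^+ 2.
  lra.
exists (C + (1 - ln c)).
  have : 0 < C by rewrite mulr_gt0.
  have := ln_le0 cle1; lra.
move=> n tn; apply: le_trans (main n tn).
rewrite -[c in leRHS]lnK ?posrE // -expRD ler_expR.
have := sqr_ge0 (ln n.+1%:R : R); have := ln_le0 cle1.
have : 0 < C by rewrite mulr_gt0.
set l := ln c; set y := ln _ ^+ 2; nra.
Qed.

Lemma tree_weight_inv_le : exists2 C : R, 0 < C & forall n (L : R),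
  0 < tw n -> ln n%:R <= L -> (tw n)^-1 <= expR (C * (1 + L ^+ 2)).
Proof.
have [C C0 twC] := tree_weight_ge; exists C => // -[|n] L tn lnL.
  by move: tn; rewrite /tree_weight forest_weightn0 ltxx.
have ln0 : 0 <= ln n.+1%:R :> R by rewrite ln_ge0 // ler1n.
rewrite -[leRHS]invrK lef_pV2 ?posrE ?invr_gt0 ?expR_gt0 //.
apply: le_trans (twC n tn); rewrite mulNr expRN lef_pV2 ?posrE ?expR_gt0 //.
rewrite ler_expR ler_wpM2l ?(ltW C0) // lerD2l lerXn2r ?nnegrE //.
exact: le_trans lnL.
Qed.

End TreeSizeBound.

(** * Trees with prescribed outdegrees *)

Fixpoint prefix_nodes (i : nat) (ls : seq (seq (seq nat * nat))) :
    seq (seq nat * nat) :=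
  if ls is l :: ls' then
    [seq (i :: u.1, u.2) | u <- l] ++ prefix_nodes i.+1 ls'
  else [::].

(** Pairs of an address and an outdegree, so that both the code and the
    conditions that gw_tree_is imposes can be read off one list. *)
Fixpoint nodes (t : tree) : seq (seq nat * nat) :=
  let: Node ts := t in ([::], size ts) :: prefix_nodes 0 (map nodes ts).

Lemma code_nodes t : map snd (nodes t) = code t.
Proof.
elim/tree_ind_children: t => ts /all_childrenP IH /=; congr cons.
elim: ts 0%N IH => //= t ts IHts i [ht] /IHts h.
rewrite map_cat h -ht -map_comp; congr cat; exact: eq_map.
Qed.

Lemma mem_prefix_nodes ts i u d : (u, d) \in prefix_nodes i (map nodes ts) <->
  exists j v t, [/\ onth ts j = Some t, u = (i + j)%N :: v & (v, d) \in nodes t].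
Proof.
elim: ts i u => [|t ts IH] i u /=; first by split=> // -[[|j] [v [t []]]].
rewrite mem_cat; split=> [/orP[/mapP[[v e] hv [-> ->]]|/IH[j [v [s [hs -> hv]]]]]|].
- by exists 0%N, v, t; rewrite addn0.
- by exists j.+1, v, s; rewrite addnS.
case=> -[|j] [v [s [hs ->  hv]]]; apply/orP.
  by left; case: hs => ->; apply/mapP; exists (v, d) => //=; rewrite addn0.
by right; apply/IH; exists j, v, s; rewrite addSnnS.
Qed.

Lemma mem_nodes t u d : (u, d) \in nodes t <->
  exists2 s, subtree_at t u = Some s & d = size (children s).
Proof.
elim/tree_ind_children: t u d => ts IH u d /=; rewrite in_cons.
case: u => [|i u]; split.
- case/orP => [/eqP[->]|/mem_prefix_nodes[j [v [t []]]]] //.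
  by exists (Node ts).
- by case=> s [<-] ->; rewrite eqxx.
- case/orP => [/eqP[]|/mem_prefix_nodes[j [v [t [hj [-> ->]]]]]] //.
  by rewrite add0n /= hj => /(IH _ _ hj).
- case=> s; rewrite [subtree_at _ _]/= [onth _ _]/=; case E: (onth ts i) => [c|//] hs ->; apply/orP; right.
  apply/mem_prefix_nodes; exists i, u, c; split=> //.
  by apply/(IH _ _ E); exists s.
Qed.

Lemma uniq_addresses t : uniq (map fst (nodes t)).
Proof.
elim/tree_ind_children: t => ts /all_childrenP IH /=; apply/andP; split.
  apply/negP => /mapP[[u d] /mem_prefix_nodes[j [v [t [_ -> _]]]]] //.
elim: ts 0%N IH => //= t ts IHts i [ht] /IHts h.
rewrite map_cat cat_uniq h andbT -map_comp; apply/andP; split.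
  rewrite (eq_map (g := cons i \o fst)) // map_comp map_inj_uniq //.
  by move=> ? ? [].
apply/hasPn => u /mapP[[u' d] /mem_prefix_nodes[j [v [s [_ -> _]]]] /= ->].
by apply/negP => /mapP[[v' e] _ /= []]; lia.
Qed.

(** The outdegrees determine a tree from the root downwards. Hence the events
    that the Galton-Watson tree equals a given tree are disjoint. *)
Lemma tree_outdegrees_inj (D : seq nat -> nat) t t' :
  (forall u s, subtree_at t u = Some s -> D u = size (children s)) ->
  (forall u s, subtree_at t' u = Some s -> D u = size (children s)) -> t = t'.
Proof.
elim/tree_ind_children: t D t' => ts IH D [ts'] h h'.
have sz : size ts = size ts' by rewrite -(h [::] _ erefl) (h' [::] _ erefl).
congr Node; apply/(@eq_onthP _ ts ts' 0%N 2%N) => i.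
case E: (onth ts i) => [c|]; last first.
  by apply/esym/onth_default; rewrite -sz -onthNE E.
have : onth ts' i by rewrite onthTE -sz -onthTE E.
case E': (onth ts' i) => [c'|//] _; congr Some.
apply: (IH i c E (fun u => D (i :: u))) => u s hs.
  by apply: (h (i :: u)); rewrite /= E.
by apply: (h' (i :: u)); rewrite /= E'.
Qed.

(** * The law of the Galton-Watson tree *)

Section GaltonWatsonLaw.
Context (d : measure_display) (Omega : measurableType d) (R : realType)
  (P : probability Omega R).

Definition offspring_pmf (xi : {RV P >-> nat}) (i : nat) : R :=
  fine (P (xi @^-1` [set i])).

Lemma measurable_preimage_nat (xi : {RV P >-> nat}) (A : set nat) :
  measurable (xi @^-1` A).
Proof. by rewrite -[X in measurable X]setTI; apply: measurable_funP. Qed.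

Lemma offspring_pmfE (xi : {RV P >-> nat}) i :
  (offspring_pmf xi i)%:E = P (xi @^-1` [set i]).
Proof. by rewrite fineK // fin_num_measure //; apply: measurable_preimage_nat. Qed.

Lemma offspring_pmf_ge0 (xi : {RV P >-> nat}) i : 0 <= offspring_pmf xi i.
Proof. by rewrite -lee_fin offspring_pmfE. Qed.

Lemma integral_offspring (xi : {RV P >-> nat}) (g : nat -> R) :
  (forall i, 0 <= g i) ->
  (\int[P]_w (g (xi w))%:E = \sum_(0 <= i <oo) (g i * offspring_pmf xi i)%:E)%E.
Proof.
move=> g0.
have TE : [set: Omega] = \bigcup_i (xi @^-1` [set i]).
  by apply/seteqP; split=> // w _; exists (xi w).
have mg : measurable_fun [set: Omega] (EFin \o (g \o xi)).
  apply/measurable_EFinP; apply: (@measurableT_comp _ _ _ _ _ _ g) => //.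
rewrite TE ge0_integral_bigcup //; first last.
- by apply/trivIsetP => i j _ _ ij; rewrite -preimage_setI; apply/seteqP;
    split=> // w /= [e1 e2]; move: ij; rewrite -e1 -e2 eqxx.
- by move=> w _; rewrite lee_fin.
- by rewrite -TE.
- by move=> i; apply: measurable_preimage_nat.
apply: eq_eseriesr => i _.
rewrite (eq_integral (cst (g i)%:E)); last first.
  by move=> w; rewrite inE /= => ->.
rewrite integral_cst ?EFinM ?offspring_pmfE //; exact: measurable_preimage_nat.
Qed.

Lemma cvg_offspring_sum (xi : {RV P >-> nat}) (g : nat -> R) (l : R) :
  (forall i, 0 <= g i) -> (\int[P]_w (g (xi w))%:E = l%:E)%E ->
  \sum_(i < D) g i * offspring_pmf xi i @[D --> \oo] --> l.
Proof.
move=> g0; rewrite integral_offspring // => hl.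
have gp0 i : true -> (0 <= (g i * offspring_pmf xi i)%:E)%E.
  by rewrite lee_fin mulr_ge0 ?offspring_pmf_ge0.
have cv : cvg (\sum_(0 <= i < D) (g i * offspring_pmf xi i)%:E @[D --> \oo])%E.
  by apply: is_cvg_nneseries => i _ _; apply: gp0.
have : (\sum_(0 <= i < D) (g i * offspring_pmf xi i)%:E @[D --> \oo] --> l%:E)%E.
  by rewrite -hl.
under eq_fun do rewrite sumEFin.
move/fine_cvgP => [_]; apply: cvg_trans; apply: near_eq_cvg; near=> D.
by rewrite /= big_mkord.
Unshelve. all: by end_near. Qed.

Lemma critical_law_offspring (xi : {RV P >-> nat}) :
  ('E_P[fun w => (xi w)%:R : R] = 1)%E ->
  (0 < 'V_P[fun w => (xi w)%:R : R])%E ->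
  ('V_P[fun w => (xi w)%:R : R] < +oo)%E ->
  critical_law (offspring_pmf xi).
Proof.
set p := offspring_pmf xi => hE.
have p0 := offspring_pmf_ge0 xi.
have Var : 'V_P[fun w => (xi w)%:R : R] =
    (\int[P]_w ((((xi w)%:R - 1) ^+ 2 : R)%:E))%E.
  rewrite /variance unlock hE expectation.unlock; apply: eq_integral => w _.
  by rewrite /= -expr2.
rewrite Var => V0 Vfin.
have law1 : \sum_(i < D) p i @[D --> \oo] --> (1 : R).
  have -> : (fun D => \sum_(i < D) p i) = (fun D => \sum_(i < D) 1 * p i).
    by apply/funext => D; apply: eq_bigr => i _; rewrite mul1r.
  apply: (@cvg_offspring_sum xi (fun=> 1) 1) => //.
  by rewrite integral_cst // mul1e; apply: probability_setT.
have lawm : \sum_(i < D) i%:R * p i @[D --> \oo] --> (1 : R).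
  apply: (@cvg_offspring_sum xi (fun i => i%:R) 1) => //.
  by rewrite -hE expectation.unlock.
have sq0 (i : nat) : 0 <= (i%:R - 1) ^+ 2 :> R by apply: sqr_ge0.
have Vge0 : (0 <= \int[P]_w ((((xi w)%:R - 1) ^+ 2 : R)%:E))%E by apply: ltW.
have lawv := @cvg_offspring_sum xi (fun i => (i%:R - 1) ^+ 2)
   (fine (\int[P]_w ((((xi w)%:R - 1) ^+ 2 : R)%:E))%E) sq0.
rewrite fineK ?ge0_fin_numE // in lawv.
have {}lawv := lawv erefl.
set W := fine _ in lawv.
split=> //.
  exists (W + 2) => D.
  have hW : \sum_(i < D) (i%:R - 1) ^+ 2 * p i <= W.
    apply: (@partial_sum_le _ (fun i => (i%:R - 1) ^+ 2 * p i)) => // i.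
    by rewrite mulr_ge0.
  have hm : \sum_(i < D) i%:R * p i <= 1.
    by apply: (@partial_sum_le _ (fun i => i%:R * p i)) => // i; rewrite mulr_ge0.
  have : \sum_(i < D) i%:R ^+ 2 * p i <=
     \sum_(i < D) ((i%:R - 1) ^+ 2 * p i + 2 * (i%:R * p i)).
    apply: ler_sum => i _; have pi0 : 0 <= p i := p0 i.
    rewrite -subr_ge0 (_ : _ - _ = p i) //; ring.
  rewrite big_split /= -mulr_sumr; lra.
(* Without branching the mean 1 forces [p 1 = 1], and the variance vanishes. *)
apply: contrapT => no.
have pz i : (2 <= i)%N -> p i = 0.
  move=> i2; apply/eqP; rewrite eq_le p0 andbT leNgt; apply/negP => pi.
  by apply: no; exists i.
have p1 : p 1%N = 1.
  apply: (cvg_unique _ _ lawm) => //.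
  apply: cvg_near_cst; near=> D.
  have D2 : (2 <= D)%N by near: D; apply: nbhs_infty_ge.
  move: (D) D2 => [|[|D']] // _.
  rewrite !big_ord_recl /= mul0r add0r mul1r big1 ?addr0 // => i _.
  by rewrite pz ?mulr0.
have p00 : p 0%N = 0.
  have : \sum_(i < 2) p i <= 1 by apply: partial_sum_le.
  rewrite !big_ord_recl big_ord0 /= /bump /= addr0 p1 => h.
  by apply/eqP; rewrite eq_le p0 andbT; lra.
move: V0; rewrite (integral_offspring xi sq0).
rewrite eseries0 ?ltxx // => i _ _.
case: i => [|[|i]]; rewrite -/p ?p00 ?mulr0 ?subrr ?expr0n ?mul0r //.
by rewrite pz // mulr0.
Unshelve. all: by end_near. Qed.

End GaltonWatsonLaw.

Section GaltonWatsonCodes.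
Context (d : measure_display) (Omega : measurableType d) (R : realType)
  (P : probability Omega R).
Variables (xi : {RV P >-> nat}) (X : seq nat -> {RV P >-> nat}).
Hypothesis X_iid : iid_copies xi X.
Notation p := (offspring_pmf xi).

Let p_ge0 := offspring_pmf_ge0 xi.

Lemma gw_tree_is_nodes w t :
  gw_tree_is X w t <-> forall u, u \in map fst (nodes t) ->
    [set i | (u, i) \in nodes t] (X u w).
Proof.
split=> [h u /mapP[[v i] hv /= ->]|h u s hs].
  by have /mem_nodes[s hs _] := hv; rewrite (h v s hs); apply/mem_nodes; exists s.
have hu : (u, size (children s)) \in nodes t by apply/mem_nodes; exists s.
have /h /mem_nodes[s'] : u \in map fst (nodes t).
  by apply/mapP; exists (u, size (children s)).
by rewrite hs => -[<-].
Qed.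

Lemma nodes_outdegree t u i j :
  (u, i) \in nodes t -> (u, j) \in nodes t -> i = j.
Proof.
by move=> /mem_nodes[s hs ->] /mem_nodes[s']; rewrite hs => -[<-] ->.
Qed.

(** The event constrains each address of [t] exactly once, so independence turns
    it into a product. *)
Lemma prob_gw_tree_is t :
  measurable [set w | gw_tree_is X w t] /\
  P [set w | gw_tree_is X w t] = (weight p (code t))%:E.
Proof.
pose A u := [set i | (u, i) \in nodes t].
have -> : [set w | gw_tree_is X w t] =
    [set w | forall u, u \in map fst (nodes t) -> A u (X u w)].
  by apply/seteqP; split=> w /gw_tree_is_nodes.
split.
  have -> : [set w | forall u, u \in map fst (nodes t) -> A u (X u w)] =
      \bigcap_(u in [set` map fst (nodes t)]) (X u @^-1` A u) by [].
  by apply: fin_bigcap_measurable => // u _; apply: measurable_preimage_nat.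
have [indep ident] := X_iid.
rewrite indep ?uniq_addresses // big_map -code_nodes /weight big_map -prodEFin.
rewrite !big_seq; apply: eq_bigr => -[u i] hu /=.
have -> : A u = [set i].
  by apply/seteqP; split=> j /= => [hj|->//]; apply: nodes_outdegree hj hu.
by rewrite offspring_pmfE; apply: ident.
Qed.

Lemma gw_probE n (A : set tree) :
  gw_prob X (A `&` [set t | Defs.tsize t = n]) =
  word_sum p n n (fun c => (codes_forest c 1 && `[< A (decode c) >])%:R).
Proof.
rewrite /gw_prob.
pose cs := [seq c <- words n n | codes_forest c 1 && `[< A (decode c) >]].
have -> : [set w | exists2 t, (A `&` [set t | Defs.tsize t = n]) t & gw_tree_is X w t] =
    \bigcup_(c in [set` cs]) [set w | gw_tree_is X w (decode c)].
  apply/seteqP; split=> w /=.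
    move=> [t [At tn] ht]; exists (code t); rewrite /= ?codeK //.
    rewrite mem_filter codes_forest_code1 codeK asboolT //=.
    by rewrite -tn -size_code code_in_words ?codes_forest_code1.
  move=> [c /=]; rewrite mem_filter => /andP[/andP[hc /asboolP Ac] cw] hw.
  exists (decode c) => //; split=> //=.
  by move: cw; rewrite mem_words -size_code decodeK // => /andP[/eqP].
rewrite measure_fin_bigcup //; first last.
- by move=> c _; have [] := prob_gw_tree_is (decode c).
- move=> c c' /=; rewrite !mem_filter => /andP[/andP[hc _] _] /andP[/andP[hc' _] _].
  move=> [w [h h']]; rewrite -(decodeK hc) -(decodeK hc'); congr code.
  exact: (tree_outdegrees_inj (D := fun u => X u w)).
- exact: finite_seq.
rewrite -fsbig_seq ?filter_uniq ?uniq_words // big_filter.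
rewrite (eq_bigr (fun c => (weight p (code (decode c)))%:E)); last first.
  by move=> c _; have [] := prob_gw_tree_is (decode c).
rewrite sumEFin /= /word_sum big_mkcond /=; apply: eq_bigr => c _.
by case: ifP => [/andP[hc _]|]; rewrite ?mulr1 ?mulr0 ?decodeK.
Qed.

Lemma gw_prob1 t : gw_prob X [set t] = weight p (code t).
Proof.
rewrite /gw_prob (_ : [set w | _] = [set w | gw_tree_is X w t]).
  by have [_ ->] := prob_gw_tree_is t.
by apply/seteqP; split=> w /= => [[_ ->]|ht] //; exists t.
Qed.

Lemma gw_prob_size n : gw_prob X [set t | Defs.tsize t = n] = tree_weight p n.
Proof.
rewrite -[X in gw_prob _ X]setTI gw_probE; apply: eq_word_sum => c _.
by rewrite asboolT // andbT.
Qed.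

Lemma le_gw_cond_prob n (A B : set tree) :
  (forall t, Defs.tsize t = n -> A t -> B t) ->
  gw_cond_prob X n A <= gw_cond_prob X n B.
Proof.
move=> AB; rewrite /gw_cond_prob gw_prob_size ler_wpM2r ?invr_ge0 ?tree_weight_ge0 //.
rewrite !gw_probE; apply: ler_word_sum => // c cn.
case: (boolP (_ && _)) => [/andP[hc /asboolP Ac]|_]; last exact: ler0n.
rewrite hc asboolT //; apply: AB => //.
by rewrite -size_code decodeK.
Qed.

Lemma gw_cond_prob_ge0 n A : 0 <= gw_cond_prob X n A.
Proof.
rewrite /gw_cond_prob gw_prob_size divr_ge0 ?tree_weight_ge0 // gw_probE.
by apply: word_sum_ge0 => // c; apply: ler0n.
Qed.

Lemma gw_cond_probU n A B :
  gw_cond_prob X n (A `|` B) <= gw_cond_prob X n A + gw_cond_prob X n B.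
Proof.
rewrite /gw_cond_prob gw_prob_size -mulrDl ler_wpM2r ?invr_ge0 ?tree_weight_ge0 //.
rewrite !gw_probE -word_sum_add; apply: ler_word_sum => // c cn.
rewrite asbool_or; case: codes_forest => //=; last by rewrite addr0.
by case: asboolP => _; case: asboolP => _ /=; rewrite ?addr0 ?add0r // lerDl.
Qed.

Lemma gw_cond_probC n A : 0 < tree_weight p n ->
  gw_cond_prob X n (~` A) = 1 - gw_cond_prob X n A.
Proof.
move=> tn; apply/eqP; rewrite eq_sym subr_eq eq_sym; apply/eqP.
rewrite /gw_cond_prob gw_prob_size -mulrDl -(divff (lt0r_neq0 tn)); congr (_ / _).
rewrite !gw_probE -word_sum_add; apply: eq_word_sum => c cn.
rewrite asbool_neg; case: codes_forest => //=; last by rewrite addr0.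
by case: asboolP => _ /=; rewrite ?addr0 ?add0r.
Qed.

Hypothesis law : critical_law p.

Lemma gw_cond_prob_contains n s : 0 < tree_weight p (Defs.tsize s) ->
  gw_cond_prob X n [set t | fringe_subtree t s] <=
  n%:R * weight p (code s) / tree_weight p (Defs.tsize s).
Proof.
move=> ts; rewrite /gw_cond_prob gw_prob_size.
have [->|tn] := eqVneq (tree_weight p n) 0.
  rewrite invr0 mulr0 divr_ge0 ?tree_weight_ge0 // mulr_ge0 //.
  exact: weight_ge0.
have {}tn : 0 < tree_weight p n by rewrite lt_neqAle eq_sym tn tree_weight_ge0.
rewrite ler_pdivrMr // mulrAC ler_pdivlMr //.
have := tree_weight_contain p_ge0 (codes_forest_code1 s) (leqnn n).
rewrite size_code; apply: le_trans; rewrite ler_wpM2r ?(ltW ts) //.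
rewrite gw_probE; apply: ler_word_sum => // c _.
case hc : codes_forest => //=; case: asboolP => [/fringe_subtreeP|_]; last exact: ler0n.
by rewrite decodeK // => ->.
Qed.

Lemma gw_cond_prob_avoids n s : (Defs.tsize s <= n)%N ->
  gw_cond_prob X n [set t | ~ fringe_subtree t s] <=
  (1 - weight p (code s)) ^+ (n %/ Defs.tsize s) / tree_weight p n.
Proof.
move=> sn; rewrite /gw_cond_prob gw_prob_size ler_wpM2r ?invr_ge0 ?tree_weight_ge0 //.
have cw : code s \in words n (size (code s)).
  by apply: code_in_words; rewrite ?codes_forest_code1 ?size_code.
have := word_sum_avoid p_ge0 (law_sum_le1 law) n (_ : 0 < size (code s))%N cw.
rewrite {1}size_code (_ : 0 < Defs.tsize s)%N; last by case: (s).
rewrite size_code => /(_ isT); apply: le_trans; rewrite gw_probE.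
apply: ler_word_sum => // c _.
case hc : codes_forest => /=; last exact: ler0n.
case: asboolP => [|_]; last exact: ler0n.
by move=> /fringe_subtreeP/negP; rewrite decodeK // => ->.
Qed.

End GaltonWatsonCodes.

(** * Asymptotics of the threshold *)

Section Asymptotics.
Variable R : realType.
Implicit Types (x gamma delta E B : R).

Lemma cvgr_ln_pinfty : @ln R x @[x --> +oo] --> +oo.
Proof.
apply/cvgryPge => A; near=> x; rewrite -[A]expRK ler_ln ?posrE ?expR_gt0 //.
Unshelve. all: by end_near. Qed.

Lemma near_ln_le (eta : R) : 0 < eta -> \forall x \near +oo, ln x <= eta * x.
Proof.
move=> e0; have e2 : 0 < eta / 2 by rewrite divr_gt0.
near=> x.
have x0 : 0 < x by near: x; apply: nbhs_pinfty_gt.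
have ex0 : 0 < eta / 2 * x by rewrite mulr_gt0.
have xE : ln x = ln (eta / 2 * x) - ln (eta / 2).
  by rewrite lnM ?posrE // addrAC subrr add0r.
have h1 := ln_sublinear ex0.
have h2 : - ln (eta / 2) / (eta / 2) <= x.
  by near: x; apply: nbhs_pinfty_ge; rewrite num_real.
rewrite ler_pdivrMr // in h2; lra.
Unshelve. all: by end_near. Qed.

Lemma near_expR_ge (k : nat) (C : R) :
  \forall x \near +oo, C * x ^+ k <= expR x.
Proof.
near=> x.
have x0 : 0 < x by near: x; apply: nbhs_pinfty_gt.
have k0 : 0 < k.+1%:R :> R by rewrite ltr0n.
have -> : expR x = expR (x / k.+1%:R) ^+ k.+1.
  by rewrite -expRM_natr divfK ?gt_eqF.
apply: (@le_trans _ _ ((x / k.+1%:R) ^+ k.+1)); last first.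
  rewrite lerXn2r ?nnegrE ?expR_ge0 ?divr_ge0 ?(ltW x0) //.
  by apply: le_trans (expR_ge1Dx _); rewrite lerDr.
rewrite exprMn exprS -mulrA [x ^+ k * _]mulrC mulrA.
rewrite ler_wpM2r ?exprn_ge0 ?(ltW x0) // -ler_pdivrMr ?exprn_gt0 ?invr_gt0 //.
Unshelve. all: by end_near. Qed.

(** In terms of [x = ln (ln n / gamma)], the relative second-order correction in
    the threshold, and the threshold with constant [c]. *)
Definition rel_corr x : R := ln x / (x * (x - ln x)).

Definition scaled_threshold c x : R := expR x / (x - ln x) * (1 - c * rel_corr x).

Lemma ln1B_ge (a : R) : 0 <= a -> a < 1 -> - (a / (1 - a)) <= ln (1 - a).
Proof.
move=> a0 a1; have b0 : 0 < 1 - a by lra.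
have aE : 1 - a = (1 + a / (1 - a))^-1.
  by field; apply/andP; split; lra.
rewrite [X in _ <= ln X]aE.
have c0 : 0 <= a / (1 - a) by rewrite divr_ge0 // ltW.
rewrite lnV; last by rewrite posrE; lra.
by rewrite lerN2; apply: le_ln1Dx; lra.
Qed.

Lemma ln1B_le (a : R) : a < 1 -> ln (1 - a) <= - a.
Proof. by move=> a1; apply: le_ln1Dx; lra. Qed.

Lemma near_basic (eta : R) : 0 < eta -> \forall x \near +oo,
  [/\ 2 <= x, 1 <= ln x, ln x <= eta * x & x / 2 <= x - ln x].
Proof.
move=> e0; have h2 : 0 < 2^-1 :> R by rewrite invr_gt0.
near=> x.
split.
- by near: x; apply: nbhs_pinfty_ge.
- by near: x; move/cvgryPge: cvgr_ln_pinfty; apply.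
- by near: x; apply: near_ln_le.
- have : ln x <= 2^-1 * x by near: x; apply: near_ln_le.
  lra.
Unshelve. all: by end_near. Qed.

Lemma rel_corr_bounds x : 2 <= x -> 1 <= ln x -> x / 2 <= x - ln x ->
  [/\ 0 < rel_corr x, 1 <= rel_corr x * x ^+ 2 & rel_corr x <= 2 * (ln x / x)].
Proof.
move=> x1 l1 hD; have x0 : 0 < x by lra.
have D0 : 0 < x - ln x by lra.
have xD : 0 < x * (x - ln x) by rewrite mulr_gt0.
split; first by rewrite divr_gt0 //; lra.
  rewrite /rel_corr mulrAC ler_pdivlMr // mul1r expr2 mulrA.
  have : x * (x - ln x) <= x * x by rewrite ler_wpM2l //; lra.
  have : x * x <= ln x * (x * x) by rewrite ler_peMl // mulr_ge0 //; lra.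
  by rewrite -mulrA; lra.
rewrite /rel_corr ler_pdivrMr //.
have -> : 2 * (ln x / x) * (x * (x - ln x)) = ln x * (2 * (x - ln x)).
  by field; lra.
by rewrite ler_peMr //; lra.
Qed.

(** Since [rel_corr x >= x ^ (- 2)], a relative change of that order moves the
    exponent [expR x] by more than any polynomial in [x]. *)
Lemma near_gain (A a : R) : 0 < a ->
  \forall x \near +oo, A * x ^+ 2 <= a * (expR x * rel_corr x).
Proof.
move=> a0; near=> x.
have [x2 l1 _ hD] : [/\ 2 <= x, 1 <= ln x, ln x <= 1 * x & x / 2 <= x - ln x] by near: x; apply: near_basic.
have ex : `|A| / a * x ^+ 4 <= expR x by near: x; apply: near_expR_ge.
have [rho0 rho1 _] := rel_corr_bounds x2 l1 hD.
have x20 : 0 <= x ^+ 2 by apply: sqr_ge0.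
apply: (@le_trans _ _ (`|A| * x ^+ 2)); first by rewrite ler_wpM2r // ler_norm.
rewrite -ler_pdivrMl // mulrA [a^-1 * _]mulrC.
apply: (@le_trans _ _ (`|A| / a * x ^+ 4 * rel_corr x)); last first.
  by rewrite ler_wpM2r // ltW.
have -> : `|A| / a * x ^+ 4 * rel_corr x = `|A| / a * x ^+ 2 * (rel_corr x * x ^+ 2).
  by ring.
by rewrite ler_peMr // mulr_ge0 // divr_ge0 // ltW.
Unshelve. all: by end_near. Qed.

Lemma gapE x : 0 < x -> 0 < x - ln x ->
  ln (x - ln x) = ln x + ln (1 - ln x / x) /\ ln x / x = rel_corr x * (x - ln x).
Proof.
move=> x0 D0; have Dx : x - ln x = x * (1 - ln x / x).
  by rewrite mulrBr mulr1 mulrCA divff ?mulr1 // gt_eqF.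
have r1 : 0 < 1 - ln x / x by rewrite -(pmulr_rgt0 _ x0) -Dx.
split; first by rewrite -lnM ?posrE // -Dx.
by rewrite /rel_corr; field; rewrite !gt_eqF.
Qed.

(** [x - ln (x - ln x)] is the logarithm of the leading term
    [expR x / (x - ln x)] of the threshold. It exceeds [x - ln x] by
    [- ln (1 - ln x / x)], that is by about [ln x / x], which is the relative
    amount [rel_corr x]. This is where the constant 1 in the corrections
    [1 + delta] and [1 - delta] comes from. *)
Lemma ln_gap_le x delta : 2 <= x -> 1 <= ln x -> x / 2 <= x - ln x -> 0 < delta ->
  ln x <= (delta / 2) / (1 + delta / 2) * x ->
  x - ln (x - ln x) <= (x - ln x) * (1 + (1 + delta / 2) * rel_corr x).
Proof.
move=> x2 l1 hD d0 hr; have x0 : 0 < x by lra.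
have D0 : 0 < x - ln x by lra.
have [-> rE] := gapE x0 D0.
have -> : (x - ln x) * (1 + (1 + delta / 2) * rel_corr x) =
   x - ln x + (1 + delta / 2) * (ln x / x) by rewrite rE; ring.
rewrite -ler_pdivrMr // in hr.
have r0 : 0 <= ln x / x by rewrite divr_ge0 //; lra.
move: (ln x / x) hr r0 => r hr r0; set l := ln x.
have r1 : r < 1.
  by apply: (le_lt_trans hr); rewrite ltr_pdivrMr; clear -d0; lra.
have h1 := ln1B_ge r0 r1.
have h2 : r / (1 - r) <= (1 + delta / 2) * r.
  rewrite mulrC ler_wpM2r // -[leLHS]div1r ler_pdivrMr ?subr_gt0 //.
  have d2 : 0 < 1 + delta / 2 by clear -d0; lra.
  by rewrite (ler_pdivlMr _ _ d2) in hr; clear -hr; lra.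
by clear -h1 h2; lra.
Qed.

Lemma ln_gap_ge x : 2 <= x -> 1 <= ln x -> x / 2 <= x - ln x ->
  (x - ln x) * (1 + rel_corr x) <= x - ln (x - ln x).
Proof.
move=> x2 l1 hD; have x0 : 0 < x by lra.
have D0 : 0 < x - ln x by lra.
have [-> rE] := gapE x0 D0.
have -> : (x - ln x) * (1 + rel_corr x) = x - ln x + ln x / x by rewrite rE; ring.
have : ln (1 - ln x / x) <= - (ln x / x).
  by apply: ln1B_le; rewrite ltr_pdivrMr //; lra.
lra.
Qed.

Lemma corr_mul_below delta rho : 0 <= delta -> 0 <= rho ->
  (1 + (1 + delta / 2) * rho) * (1 - (1 + delta) * rho) <= 1 - delta / 2 * rho.
Proof.
move=> d0 r0; rewrite -subr_ge0.
rewrite (_ : _ - _ = (1 + delta / 2) * (1 + delta) * rho ^+ 2); last by field.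
by rewrite !mulr_ge0 ?sqr_ge0 //; lra.
Qed.

Lemma corr_mul_above delta rho q : 0 <= delta <= 1 -> 0 <= rho <= delta / 8 ->
  0 <= q <= rho * (delta / 8) ->
  1 + delta / 2 * rho <= (1 + rho - 2 * q) * (1 - (1 - delta) * rho).
Proof.
move=> /andP[d0 d1] /andP[r0 r1] /andP[q0 q1].
have a0 : 0 <= q * ((1 - delta) * rho) by rewrite !mulr_ge0 //; lra.
have a1 : rho * ((1 - delta) * rho) <= rho * (delta / 8).
  rewrite ler_wpM2l //; apply: le_trans r1; rewrite ler_piMl //; lra.
have a2 : 0 <= delta * rho by rewrite mulr_ge0.
have -> : (1 + rho - 2 * q) * (1 - (1 - delta) * rho) =
    1 + delta * rho - rho * ((1 - delta) * rho) - 2 * q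
    + 2 * (q * ((1 - delta) * rho)) by ring.
by clear -a0 a1 a2 q1; lra.
Qed.

Lemma scaled_threshold_le_exp c x : 2 <= x -> 1 <= ln x -> x / 2 <= x - ln x ->
  0 <= c -> scaled_threshold c x <= expR x / (x - ln x) /\
  scaled_threshold c x <= expR x.
Proof.
move=> x2 l1 hD c0; have [rho0 _ _] := rel_corr_bounds x2 l1 hD.
have D1 : 1 <= x - ln x by lra.
have D0 : 0 < x - ln x by lra.
have h : scaled_threshold c x <= expR x / (x - ln x).
  by rewrite ler_piMr ?divr_ge0 ?expR_ge0 ?(ltW D0) // gerBl mulr_ge0 // ltW.
by split=> //; apply: (le_trans h); rewrite ler_piMr ?expR_ge0 // invf_le1.
Qed.

Lemma scaled_threshold_anti x c c' : 2 <= x -> 1 <= ln x ->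
  x / 2 <= x - ln x -> c <= c' -> scaled_threshold c' x <= scaled_threshold c x.
Proof.
move=> x2 l1 hD cc; have [rho0 _ _] := rel_corr_bounds x2 l1 hD.
apply: ler_wpM2l; first by rewrite divr_ge0 ?expR_ge0 //; lra.
by rewrite lerD2l lerN2 ler_wpM2r // ltW.
Qed.

(** Up to the threshold with [1 + delta], the least likely tree still has
    probability well above [1 / n]: the factors [1 + rel_corr x] of [ln k] and
    [1 - (1 + delta) * rel_corr x] of [k] leave a gain of at least
    [delta / 2 * rel_corr x], which by [near_gain] absorbs all other terms. *)
Lemma log_cost_below gamma delta E B : 0 < gamma -> 0 < delta -> 0 <= E -> 0 <= B ->
  \forall x \near +oo, forall k : R, 1 <= k -> k <= scaled_threshold (1 + delta) x ->
  k <= expR x /\ gamma * ln k * (k + E) + B * x <= gamma * expR x.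
Proof.
move=> g0 d0 E0 B0.
have eta0 : 0 < (delta / 2) / (1 + delta / 2) by rewrite divr_gt0 //; lra.
have gd0 : 0 < gamma * (delta / 2) by rewrite mulr_gt0 // divr_gt0.
have near_b := near_basic eta0.
have near_g := near_gain (gamma * E + B) gd0.
near=> z.
have [x2 l1 lx hD] : [/\ 2 <= z, 1 <= ln z,
    ln z <= (delta / 2) / (1 + delta / 2) * z & z / 2 <= z - ln z] by near: z.
have gain : (gamma * E + B) * z ^+ 2 <= gamma * (delta / 2) * (expR z * rel_corr z).
  by near: z.
move: (z) x2 l1 lx hD gain => x x2 l1 lx hD gain k k1 kT.
have [rho0 _ _] := rel_corr_bounds x2 l1 hD.
have c0 : 0 <= 1 + delta by lra.
have [thuD thu] := scaled_threshold_le_exp x2 l1 hD c0.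
split; first exact: le_trans thu.
have D1 : 1 <= x - ln x by lra.
have D0 : 0 < x - ln x by lra.
have u0 := expR_gt0 x; have k0 : 0 < k by lra.
have lnk0 : 0 <= ln k by apply: ln_ge0.
have lnk_gap : ln k <= x - ln (x - ln x).
  rewrite -[X in _ <= X - _]expRK -ln_div ?posrE // ler_ln ?posrE ?divr_gt0 //.
  exact: le_trans thuD.
have lnk_x : ln k <= x by have := ln_ge0 D1; clear -lnk_gap; lra.
have lnk := le_trans lnk_gap (ln_gap_le x2 l1 hD d0 lx).
have main : ln k * k <= expR x * (1 - delta / 2 * rel_corr x).
  apply: (@le_trans _ _ ((x - ln x) * (1 + (1 + delta / 2) * rel_corr x) *
     scaled_threshold (1 + delta) x)); first by apply: ler_pM => //; apply: ltW.
  have -> : (x - ln x) * (1 + (1 + delta / 2) * rel_corr x) *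
     scaled_threshold (1 + delta) x = expR x *
     ((1 + (1 + delta / 2) * rel_corr x) * (1 - (1 + delta) * rel_corr x)).
    by rewrite /scaled_threshold; field; rewrite gt_eqF.
  by rewrite ler_wpM2l ?expR_ge0 // corr_mul_below ?ltW.
have cost : gamma * (ln k * k) + gamma * E * ln k + B * x <=
    gamma * (expR x * (1 - delta / 2 * rel_corr x)) + (gamma * E + B) * x ^+ 2.
  have xx : x <= x ^+ 2 by rewrite expr2 ler_peMr //; clear -x2; lra.
  have h1 : gamma * E * ln k <= gamma * E * x ^+ 2.
    by rewrite ler_wpM2l ?mulr_ge0 ?(ltW g0) // (le_trans lnk_x).
  have h2 : B * x <= B * x ^+ 2 by rewrite ler_wpM2l.
  have := ler_wpM2l (ltW g0) main; clear -h1 h2; lra.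
have -> : gamma * ln k * (k + E) = gamma * (ln k * k) + gamma * E * ln k by ring.
apply: (le_trans cost); clear -gain; lra.
Unshelve. all: by end_near. Qed.

(** From the threshold with [1 - delta] on, the balance is reversed and the
    probability is well below [1 / n]. *)
Lemma log_cost_above gamma delta E B : 0 < gamma -> 0 < delta <= 1 -> 0 <= E ->
  0 <= B -> \forall x \near +oo, [/\ 1 + E <= scaled_threshold (1 - delta) x,
  scaled_threshold (1 - delta) x <= expR x &
  forall k : R, scaled_threshold (1 - delta) x <= k ->
  gamma * expR x + B * x ^+ 2 <= gamma * ln k * (k - E)].
Proof.
move=> g0 /andP[d0 d1] E0 B0.
have eta0 : 0 < delta / 16 by rewrite divr_gt0.
have gd0 : 0 < gamma * (delta / 2) by rewrite mulr_gt0 // divr_gt0.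
have near_b := near_basic eta0.
have near_g := near_gain (gamma * E + B) gd0.
have near_E := near_expR_ge 1 (2 * (1 + E)).
near=> z.
have [x2 l1 lx hD] : [/\ 2 <= z, 1 <= ln z, ln z <= delta / 16 * z &
    z / 2 <= z - ln z] by near: z.
have gain : (gamma * E + B) * z ^+ 2 <= gamma * (delta / 2) * (expR z * rel_corr z).
  by near: z.
have eE : 2 * (1 + E) * z ^+ 1 <= expR z by near: z.
have xd : 16 / delta <= z by near: z; apply: nbhs_pinfty_ge; rewrite num_real.
move: (z) x2 l1 lx hD gain eE xd => x x2 l1 lx hD gain eE xd.
have [rho0 _ rho2] := rel_corr_bounds x2 l1 hD.
have c0 : 0 <= 1 - delta by rewrite subr_ge0.
have [_ thu] := scaled_threshold_le_exp x2 l1 hD c0.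
have x0 : 0 < x by lra.
have D1 : 1 <= x - ln x by lra.
have D0 : 0 < x - ln x by lra.
have u0 := expR_gt0 x.
have rho8 : rel_corr x <= delta / 8.
  rewrite -ler_pdivrMr // in lx; clear -rho2 lx; lra.
have a1 : (1 - delta) * rel_corr x <= rel_corr x.
  by rewrite ler_piMl ?(ltW rho0) //; clear -d0; lra.
have a0 : 0 <= (1 - delta) * rel_corr x by rewrite mulr_ge0 ?(ltW rho0) ?subr_ge0.
have a2 : (1 - delta) * rel_corr x <= 2^-1 by clear -a1 rho8 d1; lra.
have uD0 : 0 < expR x / (x - ln x) by rewrite divr_gt0.
have thE : 1 + E <= scaled_threshold (1 - delta) x.
  apply: (@le_trans _ _ (expR x / (x - ln x) * 2^-1)); last first.
    by rewrite ler_wpM2l ?(ltW uD0) //; clear -a2; lra.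
  rewrite mulrAC ler_pdivlMr //.
  have : (1 + E) * (x - ln x) <= (1 + E) * x by rewrite ler_wpM2l //; clear -l1 E0; lra.
  by rewrite expr1 in eE; clear -eE; lra.
have th0 : 0 < scaled_threshold (1 - delta) x by clear -thE E0; lra.
split; [by []|by []|move=> k thk].
set th := scaled_threshold _ x in th0 thE thu thk *.
have lnth : (x - ln x) * (1 + rel_corr x) - 2 * rel_corr x <= ln th.
  have w0 : 0 < 1 - (1 - delta) * rel_corr x by clear -a2; lra.
  rewrite /th lnM ?posrE // ln_div ?posrE // expRK.
  have gap := ln_gap_ge x2 l1 hD.
  have h2 : - ((1 - delta) * rel_corr x / (1 - (1 - delta) * rel_corr x)) <=
      ln (1 - (1 - delta) * rel_corr x).
    by apply: ln1B_ge => //; rewrite -subr_gt0.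
  have h3 : (1 - delta) * rel_corr x / (1 - (1 - delta) * rel_corr x) <=
      2 * rel_corr x.
    rewrite ler_pdivrMr //; apply: (le_trans a1).
    have : rel_corr x * ((1 - delta) * rel_corr x) <= rel_corr x * 2^-1.
      by rewrite ler_wpM2l // ltW.
    clear; lra.
  clear -gap h2 h3; lra.
have lnth_le : ln th <= x by rewrite -[x]expRK ler_ln ?posrE.
have mono : gamma * ln th * (th - E) <= gamma * ln k * (k - E).
  have lth0 : 0 <= ln th by apply: ln_ge0; clear -thE E0; lra.
  have lthk : ln th <= ln k by rewrite ler_ln ?posrE // (lt_le_trans th0).
  apply: ler_pM; [by rewrite mulr_ge0 // ltW| |by rewrite ler_wpM2l // ltW|].
    by clear -thE; lra.
  by rewrite lerD2r.
apply: le_trans mono.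
have main : expR x * (1 + delta / 2 * rel_corr x) <= ln th * th.
  apply: (@le_trans _ _ (((x - ln x) * (1 + rel_corr x) - 2 * rel_corr x) * th)).
    have -> : ((x - ln x) * (1 + rel_corr x) - 2 * rel_corr x) * th = expR x *
        ((1 + rel_corr x - 2 * (rel_corr x / (x - ln x))) *
         (1 - (1 - delta) * rel_corr x)).
      by rewrite /th /scaled_threshold; field; rewrite gt_eqF.
    rewrite ler_wpM2l ?expR_ge0 // corr_mul_above ?(ltW d0) ?(ltW rho0) //.
    rewrite divr_ge0 ?(ltW rho0) ?(ltW D0) //= ler_wpM2l ?(ltW rho0) //.
    rewrite -[leLHS]div1r ler_pdivrMr //.
    have : 16 <= x * delta by rewrite -ler_pdivrMr.
    have : x / 2 * delta <= (x - ln x) * delta by rewrite ler_wpM2r // ltW.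
    clear; lra.
  by rewrite ler_wpM2r // ltW.
have h1 : gamma * E * ln th <= gamma * E * x ^+ 2.
  have xx : x <= x ^+ 2 by rewrite expr2 ler_peMr ?(ltW x0) //; clear -x2; lra.
  by rewrite ler_wpM2l ?mulr_ge0 ?(ltW g0) // (le_trans lnth_le).
have -> : gamma * ln th * (th - E) = gamma * (ln th * th) - gamma * E * ln th by ring.
have := ler_wpM2l (ltW g0) main; clear -h1 gain; lra.
Unshelve. all: by end_near. Qed.

End Asymptotics.

(** ** Limits of the correction terms *)

Section Limits.
Variable R : realType.
Implicit Types (x gamma c : R).

Lemma near_pinfty_ge (A : R) : \forall x \near +oo, A <= x.
Proof. by apply: nbhs_pinfty_ge; rewrite num_real. Qed.

Lemma cvg0_of_le (f : R -> R) :
  (forall eta : R, 0 < eta -> \forall x \near +oo, `|f x| <= eta) ->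
  f x @[x --> +oo] --> (0 : R).
Proof. by move=> h; apply/cvgr0Pnorm_le => eps /h. Qed.

Lemma cvg_inv_pinfty : x^-1 @[x --> (+oo : set_system R)] --> (0 : R).
Proof.
apply: cvg0_of_le => eta eta0; near=> x.
have x1 : 1 <= x by near: x; apply: near_pinfty_ge.
have xe : eta^-1 <= x by near: x; apply: near_pinfty_ge.
rewrite ger0_norm ?invr_ge0; last by lra.
by rewrite -[eta]invrK lef_pV2 ?posrE ?invr_gt0 //; lra.
Unshelve. all: by end_near. Qed.

Lemma cvg_ln_ratio : ln x / x @[x --> (+oo : set_system R)] --> (0 : R).
Proof.
apply: cvg0_of_le => eta eta0; near=> x.
have x1 : 1 <= x by near: x; apply: near_pinfty_ge.
have lx : ln x <= eta * x by near: x; apply: near_ln_le.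
rewrite ger0_norm; last by rewrite divr_ge0 ?ln_ge0 //; lra.
by rewrite ler_pdivrMr //; lra.
Unshelve. all: by end_near. Qed.

Lemma cvg_exp_ratio k : x ^+ k / expR x @[x --> (+oo : set_system R)] --> (0 : R).
Proof.
apply: cvg0_of_le => eta eta0; near=> x.
have x1 : 1 <= x by near: x; apply: near_pinfty_ge.
have ex : eta^-1 * x ^+ k <= expR x by near: x; apply: near_expR_ge.
have xk : 0 <= x ^+ k by rewrite exprn_ge0 //; lra.
rewrite ger0_norm ?divr_ge0 ?expR_ge0 // ler_pdivrMr ?expR_gt0 //.
by rewrite -ler_pdivrMl.
Unshelve. all: by end_near. Qed.

Lemma cvg_shift_ratio c : (x + c) / x @[x --> +oo] --> (1 : R).
Proof.
have h : 1 + c * x^-1 @[x --> +oo] --> (1 + c * 0 : R).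
  by apply: cvgD; [exact: cvg_cst|apply: cvgMr; exact: cvg_inv_pinfty].
rewrite mulr0 addr0 in h; apply: cvg_trans h; apply: near_eq_cvg; near=> x.
have x1 : 1 <= x by near: x; apply: near_pinfty_ge.
by field; lra.
Unshelve. all: by end_near. Qed.

Lemma cvg_gap_ratio : x / (x - ln x) @[x --> (+oo : set_system R)] --> (1 : R).
Proof.
have h : (1 - ln x / x)^-1 @[x --> +oo] --> ((1 - 0)^-1 : R).
  apply: cvgV; first by rewrite subr0 oner_eq0.
  by apply: cvgB; [exact: cvg_cst|exact: cvg_ln_ratio].
rewrite subr0 invr1 in h; apply: cvg_trans h; apply: near_eq_cvg; near=> x.
have x1 : 1 <= x by near: x; apply: near_pinfty_ge.
have lx : ln x < x by apply: ln_sublinear; lra.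
by field; apply/andP; split; lra.
Unshelve. all: by end_near. Qed.

Lemma cvg_rel_corr : rel_corr x @[x --> (+oo : set_system R)] --> (0 : R).
Proof.
have h : ln x / x * (x / (x - ln x)) * x^-1 @[x --> +oo] --> (0 * 1 * 0 : R).
  apply: cvgM; last exact: cvg_inv_pinfty.
  by apply: cvgM; [exact: cvg_ln_ratio|exact: cvg_gap_ratio].
rewrite mulr0 in h; apply: cvg_trans h; apply: near_eq_cvg; near=> x.
have x1 : 1 <= x by near: x; apply: near_pinfty_ge.
have lx : ln x < x by apply: ln_sublinear; lra.
by rewrite /rel_corr; field; apply/andP; split; lra.
Unshelve. all: by end_near. Qed.

Lemma cvg_inv_ln : (ln x)^-1 @[x --> (+oo : set_system R)] --> (0 : R).
Proof.
apply: cvg0_of_le => eta eta0; near=> x.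
have x1 : 1 <= x by near: x; apply: near_pinfty_ge.
have xe : eta^-1 <= ln x by near: x; move/cvgryPge: (@cvgr_ln_pinfty R); apply.
have e1 : 0 < eta^-1 by rewrite invr_gt0.
rewrite ger0_norm ?invr_ge0; last by lra.
by rewrite -[leRHS]invrK lef_pV2 ?posrE //; lra.
Unshelve. all: by end_near. Qed.

Lemma cvg_ln_shift c : ln x / ln (x + c) @[x --> +oo] --> (1 : R).
Proof.
have hl : ln ((x + c) / x) @[x --> +oo] --> (0 : R).
  rewrite -(@ln1 R); apply: (continuous_cvg _ _ (cvg_shift_ratio c)).
  exact: continuous_ln.
have h : (1 + ln ((x + c) / x) * (ln x)^-1)^-1 @[x --> +oo] --> ((1 + 0 * 0)^-1 : R).
  apply: cvgV; first by rewrite mul0r addr0 oner_eq0.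
  by apply: cvgD; [exact: cvg_cst|apply: cvgM => //; exact: cvg_inv_ln].
rewrite mul0r addr0 invr1 in h; apply: cvg_trans h; apply: near_eq_cvg; near=> x.
have x1 : 1 <= x by near: x; apply: near_pinfty_ge.
have xc : 2 - c <= x by near: x; apply: near_pinfty_ge.
have lx1 : 1 <= ln x by near: x; move/cvgryPge: (@cvgr_ln_pinfty R); apply.
have lc1 : 0 < ln (x + c) by apply: ln_gt0; lra.
rewrite ln_div ?posrE; [|lra|lra].
by field; apply/andP; split; lra.
Unshelve. all: by end_near. Qed.

Lemma cvg_threshold gamma a b : 0 < gamma ->
  (scaled_threshold a x + b) * ((x + ln gamma) / (gamma * expR x))
  @[x --> +oo] --> (1 / gamma : R).
Proof.
move=> g0.
have h : gamma^-1 * ((x + ln gamma) / x) *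
   (x / (x - ln x) * (1 - a * rel_corr x) + b * (x ^+ 1 / expR x))
   @[x --> +oo] --> (gamma^-1 * 1 * (1 * (1 - a * 0) + b * 0) : R).
  apply: cvgM; first by apply: cvgMr; exact: cvg_shift_ratio.
  apply: cvgD; last by apply: cvgMr; exact: cvg_exp_ratio.
  apply: cvgM; first exact: cvg_gap_ratio.
  by apply: cvgB; [exact: cvg_cst|apply: cvgMr; exact: cvg_rel_corr].
rewrite !mulr0 addr0 subr0 !mulr1 -[X in _ --> X]div1r in h.
apply: cvg_trans h; apply: near_eq_cvg; near=> x.
have x1 : 1 <= x by near: x; apply: near_pinfty_ge.
have lx : ln x < x by apply: ln_sublinear; lra.
have e0 : 0 < expR x := expR_gt0 x.
rewrite expr1 /scaled_threshold; field.
by rewrite !gt_eqF //; lra.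
Unshelve. all: by end_near. Qed.

(** With [c = ln gamma] and [x = ln (ln n / gamma)] this is
    [(ln ln n) ^ 2 / ln ln ln n]. *)
Definition second_order_scale c x : R := (x + c) ^+ 2 / ln (x + c).

Lemma cvg_corr_scale c :
  rel_corr x * second_order_scale c x @[x --> +oo] --> (1 : R).
Proof.
have h : x / (x - ln x) * ((x + c) / x * ((x + c) / x)) * (ln x / ln (x + c))
   @[x --> +oo] --> (1 * (1 * 1) * 1 : R).
  apply: cvgM; last exact: cvg_ln_shift.
  apply: cvgM; first exact: cvg_gap_ratio.
  by apply: cvgM; exact: cvg_shift_ratio.
rewrite !mulr1 in h; apply: cvg_trans h; apply: near_eq_cvg; near=> x.
have x1 : 1 <= x by near: x; apply: near_pinfty_ge.
have xc : 2 - c <= x by near: x; apply: near_pinfty_ge.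
have lx : ln x < x by apply: ln_sublinear; lra.
have lc1 : 0 < ln (x + c) by apply: ln_gt0; lra.
rewrite /rel_corr /second_order_scale; field.
by rewrite !gt_eqF //; lra.
Unshelve. all: by end_near. Qed.

(** Rounding the threshold to an integer changes it by a relative amount of order
    [(x - ln x) / expR x], which is negligible on the second-order scale. *)
Lemma cvg_rounding_scale c :
  (x - ln x) / expR x * second_order_scale c x @[x --> +oo] --> (0 : R).
Proof.
have h : (1 - ln x / x) * ((x + c) / x * ((x + c) / x)) * (x ^+ 3 / expR x) *
   ((ln x)^-1 * (ln x / ln (x + c)))
   @[x --> +oo] --> ((1 - 0) * (1 * 1) * 0 * (0 * 1) : R).
  apply: cvgM; last by apply: cvgM; [exact: cvg_inv_ln|exact: cvg_ln_shift].
  apply: cvgM; last exact: cvg_exp_ratio.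
  apply: cvgM; last by apply: cvgM; exact: cvg_shift_ratio.
  by apply: cvgB; [exact: cvg_cst|exact: cvg_ln_ratio].
rewrite !mulr0 mul0r in h; apply: cvg_trans h; apply: near_eq_cvg; near=> x.
have x1 : 1 <= x by near: x; apply: near_pinfty_ge.
have xc : 2 - c <= x by near: x; apply: near_pinfty_ge.
have lx1 : 1 <= ln x by near: x; move/cvgryPge: (@cvgr_ln_pinfty R); apply.
have lc1 : 0 < ln (x + c) by apply: ln_gt0; lra.
have e0 : 0 < expR x := expR_gt0 x.
rewrite /second_order_scale; field.
by rewrite !gt_eqF //; lra.
Unshelve. all: by end_near. Qed.

End Limits.

(** * Containing all trees of positive probability *)

#[local] Instance span_oo_filter h : Filter (span_oo h).
Proof. exact: within_filter. Qed.

Section ContainsAll.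
Context (d : measure_display) (Omega : measurableType d) (R : realType)
  (P : probability Omega R).
Variables (xi : {RV P >-> nat}) (X : seq nat -> {RV P >-> nat}).
Hypothesis X_iid : iid_copies xi X.
Notation p := (offspring_pmf xi).
Hypothesis law : critical_law p.
Notation tw := (tree_weight p).

Let p_ge0 := offspring_pmf_ge0 xi.

Lemma gw_cond_prob_le_sum (I : eqType) (r : seq I) n (A : set tree) (B : I -> set tree) :
  (forall t, A t -> exists2 i, i \in r & B i t) ->
  gw_cond_prob X n A <= \sum_(i <- r) gw_cond_prob X n (B i).
Proof.
elim: r A => [|i r IH] A h.
  rewrite big_nil; have -> : A = set0.
    by apply/seteqP; split=> // t /h[].
  rewrite /gw_cond_prob set0I /gw_prob (_ : [set _ | _] = set0).
    by rewrite measure0 mul0r.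
  by apply/seteqP; split=> // w [].
rewrite big_cons.
apply: (@le_trans _ _ (gw_cond_prob X n (B i `|`
   [set t | exists2 j, j \in r & B j t]))).
  apply: (le_gw_cond_prob X_iid) => t _ /h[j].
  by rewrite inE => /predU1P[->|jr] Bj; [left|right; exists j].
apply: le_trans (gw_cond_probU X_iid _ _ _) _.
by rewrite lerD2l; apply: IH.
Qed.

Lemma SplusE k s : Splus X k s <-> (Defs.tsize s <= k)%N /\ 0 < weight p (code s).
Proof. by rewrite /Splus /= (gw_prob1 X_iid). Qed.

Lemma Splus_leaf k : (0 < k)%N -> Splus X k (Node [::]).
Proof.
move=> k0; apply/SplusE; split=> //.
by rewrite /weight /= big_seq1; apply: law0_gt0 law.
Qed.

Lemma pmin_lbound k : has_lbound [set gw_prob X [set t] | t in Splus X k].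
Proof.
by exists 0 => _ [t _ <-]; rewrite (gw_prob1 X_iid); apply: weight_ge0.
Qed.

Lemma pmin_le k s : Splus X k s -> pmin X k <= weight p (code s).
Proof.
move=> hs; rewrite -(gw_prob1 X_iid).
by apply: ge_inf; [exact: pmin_lbound|exists s].
Qed.

Lemma pmin_ge0 k : (0 < k)%N -> 0 <= pmin X k.
Proof.
move=> k0; apply: lb_le_inf.
  by exists (gw_prob X [set Node [::]]); exists (Node [::]) => //; apply: Splus_leaf.
by move=> _ [t _ <-]; rewrite (gw_prob1 X_iid); apply: weight_ge0.
Qed.

Lemma pmin_le1 k : (0 < k)%N -> pmin X k <= 1.
Proof.
move=> k0; apply: le_trans (pmin_le (Splus_leaf k0)) _.
by rewrite /weight /= big_seq1; apply: law_le1 law _.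
Qed.

(** A tree within a factor 2 of the infimum serves as the rarest tree. *)
Lemma pmin_near_attained k : (0 < k)%N -> 0 < pmin X k ->
  exists2 s, Splus X k s & weight p (code s) < 2 * pmin X k.
Proof.
move=> k0 pk.
have [] := @inf_adherent _ [set gw_prob X [set t] | t in Splus X k] (pmin X k) pk.
  split; last exact: pmin_lbound.
  by exists (gw_prob X [set Node [::]]); exists (Node [::]) => //; apply: Splus_leaf.
move=> _ [s hs <-]; rewrite (gw_prob1 X_iid) => h; exists s => //.
by move: h; rewrite -/(pmin X k); lra.
Qed.

Lemma contains_all_antitone k k' t : (k <= k')%N ->
  contains_all X k' t -> contains_all X k t.
Proof.
by move=> kk h s /SplusE[sk hs]; apply: h; apply/SplusE; rewrite (leq_trans sk).
Qed.

Definition small_codes k : seq (seq nat) :=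
  [seq c <- flatten [seq words k j | j <- iota 0 k.+1] |
     codes_forest c 1 && (0 < weight p c)].

Lemma mem_small_codes k s : Splus X k s -> code s \in small_codes k.
Proof.
move=> /SplusE[sk ws]; rewrite mem_filter codes_forest_code1 ws !andTb.
apply/flattenP; exists (words k (Defs.tsize s)).
  by apply/mapP; exists (Defs.tsize s) => //; rewrite mem_iota add0n ltnS.
by rewrite -size_code code_in_words ?codes_forest_code1 // size_code.
Qed.

Lemma small_codes_Splus k c : c \in small_codes k ->
  codes_forest c 1 /\ Splus X k (decode c).
Proof.
rewrite mem_filter => /andP[/andP[hc wc] /flattenP[_ /mapP[j hj ->]]].
rewrite mem_words => /andP[/eqP sc _]; split=> //; apply/SplusE.
rewrite decodeK // -size_code decodeK // sc; split=> //.
by move: hj; rewrite mem_iota add0n ltnS.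
Qed.

Lemma size_small_codes k : (0 < k)%N -> (size (small_codes k) <= k.+1 * k ^ k)%N.
Proof.
move=> k0; rewrite size_filter; apply: leq_trans (count_size _ _) _.
rewrite size_flatten /shape -map_comp sumnE big_map.
apply: (@leq_trans (\sum_(j <- iota 0 k.+1) k ^ k)).
  rewrite !big_seq; apply: leq_sum => j; rewrite mem_iota add0n ltnS => /= jk.
  by rewrite size_words leq_pexp2l.
by rewrite big_const_seq count_predT size_iota iter_addn_0 mulnC.
Qed.

(** Each tree of the list is missed with a probability that decays
    exponentially in [n * pmin], so the union bound absorbs the number of
    trees. *)
Lemma prob_not_contains_all n k : (0 < k <= n)%N ->
  gw_cond_prob X n (~` contains_all X k) <=
  (k.+1 * k ^ k)%:R * expR (- pmin X k * (n %/ k)%:R) / tw n.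
Proof.
move=> /andP[k0 kn].
apply: (@le_trans _ _ (\sum_(c <- small_codes k)
  gw_cond_prob X n [set t | ~ fringe_subtree t (decode c)])).
  apply: gw_cond_prob_le_sum => t /existsNP[s /not_implyP[hs nf]].
  by exists (code s); [exact: mem_small_codes|rewrite /= codeK].
have p0 := pmin_ge0 k0; have p1 := pmin_le1 k0.
have tw0 : 0 <= tw n by apply: tree_weight_ge0.
apply: (@le_trans _ _ (\sum_(c <- small_codes k)
   expR (- pmin X k * (n %/ k)%:R) / tw n)).
  rewrite !big_seq; apply: ler_sum => c /small_codes_Splus[hc hs].
  have [/SplusE [sk sw] ws] := (hs, pmin_le hs).
  apply: le_trans (gw_cond_prob_avoids X_iid law (leq_trans sk kn)) _.
  rewrite ler_wpM2r ?invr_ge0 //.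
  set W := weight p _ in ws *.
  have W1 : W <= 1.
    have := weight_le_tree_weight p_ge0 (codes_forest_code1 (decode c)).
    move=> /le_trans; apply; have := tree_weight_sum_le1 law (size (code (decode c))).+1.
    by apply: le_trans; rewrite big_ord_recr /= lerDr sumr_ge0 // => i _;
      apply: tree_weight_ge0.
  apply: (@le_trans _ _ ((1 - pmin X k) ^+ (n %/ Defs.tsize (decode c)))).
    by rewrite lerXn2r ?nnegrE; lra.
  have s0 : (0 < Defs.tsize (decode c))%N by case: (decode c).
  apply: (@le_trans _ _ ((1 - pmin X k) ^+ (n %/ k))).
    by apply: ler_wiXn2l; [lra|lra|exact: leq_div2l].
  rewrite expRM_natr lerXn2r ?nnegrE ?expR_ge0 //; first by lra.
  exact: expR_ge1Dx.
rewrite big_const_seq iter_addr addr0 count_predT -[leLHS]mulr_natl mulrA.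
rewrite ler_wpM2r ?invr_ge0 // ler_wpM2r ?expR_ge0 // ler_nat.
exact: size_small_codes.
Qed.

Lemma prob_contains_all n k s : Splus X k s ->
  gw_cond_prob X n (contains_all X k) <=
  n%:R * weight p (code s) / tw (Defs.tsize s).
Proof.
move=> hs; have /SplusE[_ ws] := hs.
have ts : 0 < tw (Defs.tsize s).
  rewrite -size_code; apply: lt_le_trans ws _.
  by apply: weight_le_tree_weight => //; apply: codes_forest_code1.
apply: le_trans (gw_cond_prob_contains X_iid n ts).
by apply: (le_gw_cond_prob X_iid) => t _; apply.
Qed.

Lemma Kmax_bounds k k' t : contains_all X k t -> ~ contains_all X k' t ->
  (k <= Kmax X t < k')%N.
Proof.
move=> hk hk'.
have ub j : contains_all X j t -> (j < k')%N.
  by move=> hj; rewrite ltnNge; apply/negP => /contains_all_antitone/(_ hj).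
have ex : exists j, `[< contains_all X j t >] by exists k; apply/asboolP.
have ubb j : `[< contains_all X j t >] -> (j <= k')%N.
  by move/asboolP/ub/ltnW.
rewrite /Kmax; case: xgetP => [j _ [hj jmax]|none].
  by rewrite jmax //= ub.
have [j /asboolP hj jmax] := ex_maxnP ex ubb.
by case: (none j); split=> // i /asboolP /jmax.
Qed.

End ContainsAll.

(** * The conditioned tree at the threshold *)

Section LogScale.
Variable R : realType.
Implicit Types gamma c : R.

(** The variable [x] of the asymptotic estimates; then
    [n = exp (gamma * exp x)]. *)
Definition log_scale gamma (n : nat) : R := ln (ln n%:R / gamma).

Lemma near_log_scale gamma (Q : R -> Prop) : 0 < gamma ->
  (\forall x \near +oo, Q x) -> \forall n \near \oo, Q (log_scale gamma n).
Proof.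
move=> g0; suff h : log_scale gamma n @[n --> \oo] --> +oo by apply: h.
apply/cvgryPge => A; near=> n.
have hn : expR (gamma * expR A) <= n%:R by near: n; apply: nbhs_infty_ger.
have n0 : 0 < n%:R :> R by apply: lt_le_trans hn; apply: expR_gt0.
have lnn : gamma * expR A <= ln n%:R by rewrite -[leLHS]expRK ler_ln ?posrE ?expR_gt0.
have hA : expR A <= ln n%:R / gamma by rewrite ler_pdivlMr // mulrC.
have l0 : 0 < ln n%:R / gamma by apply: lt_le_trans hA; apply: expR_gt0.
by rewrite /log_scale -[A]expRK ler_ln ?posrE ?expR_gt0.
Unshelve. all: by end_near. Qed.

Lemma near_log_scaleE gamma : 0 < gamma -> \forall n \near \oo,
  ln n%:R = gamma * expR (log_scale gamma n) /\
  n%:R = expR (gamma * expR (log_scale gamma n)).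
Proof.
move=> g0; near=> n.
have hn : expR 1 <= n%:R :> R by near: n; apply: nbhs_infty_ger.
have n0 : 0 < n%:R :> R by apply: lt_le_trans hn; apply: expR_gt0.
have lnn : 1 <= ln n%:R :> R by rewrite -[leLHS](@expRK R) ler_ln ?posrE ?expR_gt0.
have lnE : ln n%:R = gamma * expR (log_scale gamma n).
  rewrite /log_scale lnK ?posrE; last by rewrite divr_gt0 //; lra.
  by rewrite mulrCA divff ?mulr1 // gt_eqF.
by rewrite -lnE lnK ?posrE.
Unshelve. all: by end_near. Qed.

Lemma near_thresholdE gamma : 0 < gamma -> \forall n \near \oo,
  forall c, threshold gamma c n = scaled_threshold c (log_scale gamma n).
Proof.
move=> g0; near=> n => c.
have [lnE _] : ln n%:R = gamma * expR (log_scale gamma n) /\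
  n%:R = expR (gamma * expR (log_scale gamma n)) by near: n; apply: near_log_scaleE.
rewrite /threshold -/(log_scale gamma n) /scaled_threshold /rel_corr {1}lnE.
by rewrite -mulf_div divff ?mul1r // gt_eqF.
Unshelve. all: by end_near. Qed.

Lemma near_ln_nat_le gamma : 0 < gamma ->
  \forall n \near \oo, ln n%:R <= gamma * n%:R :> R.
Proof.
move=> g0; have h : (n%:R : R) @[n --> \oo] --> +oo.
  by apply/cvgryPge => A; apply: nbhs_infty_ger.
exact: (h _ (near_ln_le g0)).
Qed.

End LogScale.

Lemma near_span_oo h (Q : nat -> Prop) :
  (\forall n \near \oo, Q n) -> \forall n \near span_oo h, Q n.
Proof. exact: cvg_within. Qed.

(** On taking logarithms, the final bounds in contains_all_below and
    contains_all_above come down to these two inequalities. *)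
Lemma exponent_below (R : realType) (u C g : R) : 1 <= u -> 0 < C -> 0 <= g ->
  2 * (3 + C + C * g) <= u ->
  u + u ^+ 2 - u ^+ 3 / 2 + C * (1 + g * u ^+ 2) <= - u.
Proof.
move=> u1 C0 g0 hu.
have u2 : 1 <= u ^+ 2 by rewrite exprn_ege1.
have uu2 : u <= u ^+ 2 by rewrite expr2 ler_peMr //; lra.
have hu3 : (2 * (3 + C + C * g)) * u ^+ 2 <= u ^+ 3.
  by rewrite [u ^+ 3]exprS ler_wpM2r ?sqr_ge0.
have C1 : C <= C * u ^+ 2 by rewrite ler_peMr // ltW.
by clear -uu2 hu3 C1; lra.
Qed.

Lemma exponent_above (R : realType) (x C : R) : 1 <= x -> 0 < C ->
  - ((5 * C + 1) * x ^+ 2) + C * (1 + (2 * x) ^+ 2) <= - x.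
Proof.
move=> x1 C0; have x2 : 1 <= x ^+ 2 by rewrite exprn_ege1.
have xx : x <= x ^+ 2 by rewrite expr2 ler_peMr //; lra.
have C1 : C <= C * x ^+ 2 by rewrite ler_peMr // ltW.
by rewrite exprMn; clear -xx C1; lra.
Qed.

Section Threshold.
Context (d : measure_display) (Omega : measurableType d) (R : realType)
  (P : probability Omega R).
Variables (xi : {RV P >-> nat}) (X : seq nat -> {RV P >-> nat}) (h : nat).
Variables (gamma : R) (e : nat -> R).
Hypothesis X_iid : iid_copies xi X.
Hypothesis h_span : is_span xi h.
Hypothesis gamma_gt0 : 0 < gamma.
Hypothesis e_bounded : e =O_\oo (fun=> 1 : R).
Hypothesis pmin_asymp : \forall i \near \oo,
  ln (1 / pmin X i) = gamma * ln i%:R * (i%:R + e i).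
Notation p := (offspring_pmf xi).
Hypothesis law : critical_law p.
Notation tw := (tree_weight p).

Let p_ge0 := offspring_pmf_ge0 xi.

Lemma near_tree_weight_gt0 : \forall n \near span_oo h, 0 < tw n.
Proof.
have [hdvd hgcd] := h_span.
have [|g [n0 [gh _ gbig]]] := @tree_weight_period _ _ law h.
  move=> g hg; apply: hgcd => i [i1 Pi]; apply: hg => //.
  by rewrite -lte_fin offspring_pmfE.
rewrite /span_oo near_withinE; near=> n => n1.
have n2 : (n0.+1 <= n)%N by near: n; apply: nbhs_infty_ge.
move: (n) n1 n2 => [//|m] n1 m2; apply: gbig => //.
apply: dvdn_trans gh _; have : (m.+1 == 1 %[mod h])%N by apply/eqP.
by rewrite eqn_mod_dvd // subn1.
Unshelve. all: by end_near. Qed.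

Lemma whp_complement (A : nat -> set tree) :
  gw_cond_prob X n (~` A n) @[n --> span_oo h] --> (0 : R) -> whp X h A.
Proof.
move=> hA; have h1 : 1 - gw_cond_prob X n (~` A n) @[n --> span_oo h] --> (1 - 0 : R).
  by apply: cvgB => //; apply: cvg_cst.
rewrite subr0 in h1; apply: cvg_trans h1; apply: near_eq_cvg; near=> n.
have tn : 0 < tw n by near: n; apply: near_tree_weight_gt0.
by rewrite (gw_cond_probC X_iid _ tn) opprB addrC subrK.
Unshelve. all: by end_near. Qed.

(** The assumed logarithm determines [pmin] only if [pmin] is nonzero. It is,
    because the logarithm of [1 / 0], that is of 0, is 0 while the assumed value
    is positive for large [k]. *)
Lemma near_pmin : exists2 E : R, 0 <= E & \forall k \near \oo,
  [/\ `|e k| <= E, 0 < pmin X k & pmin X k = expR (- (gamma * ln k%:R * (k%:R + e k)))].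
Proof.
have [E [Ereal HE]] := eqO_bigO e_bounded.
pose E1 := `|E| + 1.
have E1E : E < E1 by rewrite /E1; apply: (le_lt_trans (ler_norm E)); rewrite ltrDl.
have E10 : 0 <= E1 by rewrite addr_ge0.
have near_e := HE E1 E1E; exists E1 => //.
near=> k.
have ek : `|e k| <= E1.
  have : `|e k| <= E1 * `|1 : R| by near: k.
  by rewrite normr1 mulr1.
have k2 : (2 <= k)%N by near: k; apply: nbhs_infty_ge.
have kE : E1 + 1 <= k%:R by near: k; apply: nbhs_infty_ger.
have pE : ln (1 / pmin X k) = gamma * ln k%:R * (k%:R + e k) by near: k.
have cost0 : 0 < gamma * ln k%:R * (k%:R + e k).
  rewrite !mulr_gt0 ?ln_gt0 ?ltr1n //.
  by move: ek; rewrite ler_norml => /andP[]; lra.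
have pk : 0 < pmin X k.
  rewrite lt_neqAle (pmin_ge0 X_iid law) ?andbT; last by rewrite (leq_trans _ k2).
  apply/eqP => p0; move: cost0.
  by rewrite -pE -p0 invr0 mulr0 ln0 ?ltxx.
split=> //; rewrite -pE div1r lnV ?posrE // opprK lnK ?posrE //.
Unshelve. all: by end_near. Qed.

(** With [u = expR x], the product of [n] and the probability of the rarest tree
    is at least [expR (4 * x) = u ^+ 4], and there is room for at least
    [n / (2 * u)] blocks. So a given tree is missing with probability at most
    [expR (- u ^+ 3 / 2)], which beats the number of trees, at most
    [expR (u + u ^+ 2)], and the cost of conditioning on size [n]. *)
Lemma contains_all_below (k : nat -> nat) (delta : R) : (forall n, (0 < k n)%N) ->
  k n @[n --> span_oo h] --> \oo -> 0 < delta ->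
  (\forall n \near span_oo h, (k n)%:R <= threshold gamma (1 + delta) n) ->
  gw_cond_prob X n (~` contains_all X (k n)) @[n --> span_oo h] --> (0 : R).
Proof.
move=> k0 koo d0 kthr; apply/cvgr0Pnorm_le => eps eps0.
have [E E0 nearE] := near_pmin.
have [C C0 twC] := tree_weight_inv_le law.
have nearEk : \forall n \near span_oo h, [/\ `|e (k n)| <= E, 0 < pmin X (k n) &
    pmin X (k n) = expR (- (gamma * ln (k n)%:R * ((k n)%:R + e (k n))))].
  exact: koo _ nearE.
have near_cost := near_span_oo h (near_log_scale gamma_gt0
   (log_cost_below gamma_gt0 d0 E0 (ler0n R 4))).
have near_lnE := near_span_oo h (near_log_scaleE gamma_gt0).
have near_thr := near_span_oo h (near_thresholdE gamma_gt0).
have near_small := near_span_oo h (near_ln_nat_le gamma_gt0).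
have near_u := near_span_oo h (near_log_scale gamma_gt0
   (near_pinfty_ge (1 + eps^-1 + 2 * (3 + C + C * gamma ^+ 2)))).
near=> n.
have tn : 0 < tw n by near: n; apply: near_tree_weight_gt0.
have [eE pk pkE] : [/\ `|e (k n)| <= E, 0 < pmin X (k n) &
    pmin X (k n) = expR (- (gamma * ln (k n)%:R * ((k n)%:R + e (k n))))].
  by near: n.
have lnE : ln n%:R = gamma * expR (log_scale gamma n) /\
  n%:R = expR (gamma * expR (log_scale gamma n)) by near: n.
have thrE : forall c, threshold gamma c n = scaled_threshold c (log_scale gamma n).
  by near: n.
have kthr' : (k n)%:R <= threshold gamma (1 + delta) n by near: n.
have small : ln n%:R <= gamma * n%:R by near: n.
have xbig : 1 + eps^-1 + 2 * (3 + C + C * gamma ^+ 2) <= log_scale gamma n by near: n.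
have cost : forall k : R, 1 <= k ->
   k <= scaled_threshold (1 + delta) (log_scale gamma n) ->
   k <= expR (log_scale gamma n) /\
   gamma * ln k * (k + E) + 4 * log_scale gamma n <=
     gamma * expR (log_scale gamma n) by near: n.
have k1 : 1 <= (k n)%:R :> R by rewrite ler1n.
rewrite thrE in kthr'; have {cost} [ku cost] := cost _ k1 kthr'.
rewrite ger0_norm ?(gw_cond_prob_ge0 X_iid) //.
move: (k0 n) (log_scale gamma n) lnE pk pkE eE ku cost xbig {kthr' thrE} k1.
move: (k n) => K K0 x [lnE nE] pk pkE eE ku cost xbig K1.
have eps10 : 0 < eps^-1 by rewrite invr_gt0.
have Cg0 : 0 <= C * gamma ^+ 2 by rewrite mulr_ge0 ?sqr_ge0 // ltW.
set u := expR x in lnE nE ku cost.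
have xu : x + 1 <= u by rewrite addrC; apply: expR_ge1Dx.
have u1 : 1 <= u by lra.
have u0 : 0 < u by lra.
have un : u <= n%:R by rewrite -(ler_pM2l gamma_gt0) -lnE.
have Kn : (K <= n)%N by rewrite -(ler_nat R); lra.
apply: le_trans (prob_not_contains_all X_iid law _) _; first by rewrite K0.
have pn : expR (4 * x) <= pmin X K * n%:R.
  rewrite pkE nE -expRD ler_expR.
  have : gamma * ln K%:R * (K%:R + e K) <= gamma * ln K%:R * (K%:R + E).
    rewrite ler_wpM2l ?mulr_ge0 ?(ltW gamma_gt0) ?ln_ge0 // lerD2l.
    by move: eE; rewrite ler_norml => /andP[].
  lra.
have qn : n%:R <= 2 * K%:R * (n %/ K)%:R :> R.
  rewrite -!natrM ler_nat.
  have q1 : (1 <= n %/ K)%N by rewrite leq_divRL // mul1n.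
  have := ltn_ceil n K0; clear -q1; nia.
have expo : u ^+ 3 / 2 <= pmin X K * (n %/ K)%:R.
  have h1 : expR (4 * x) <= pmin X K * (2 * u * (n %/ K)%:R).
    apply: (le_trans pn); rewrite ler_wpM2l ?(ltW pk) //; apply: (le_trans qn).
    by rewrite ler_wpM2r // ler_wpM2l.
  have u4 : expR (4 * x) = u ^+ 4 by rewrite mulrC expRM_natr.
  rewrite u4 in h1; rewrite -(ler_pM2l u0); move: h1.
  have -> : u ^+ 4 = 2 * (u * (u ^+ 3 / 2)) by field.
  have -> : pmin X K * (2 * u * (n %/ K)%:R) = 2 * (u * (pmin X K * (n %/ K)%:R)) by ring.
  by lra.
have count : (K.+1 * K ^ K)%:R <= expR (u + u ^+ 2).
  rewrite natrM natrX expRD; apply: ler_pM => //.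
    rewrite -natr1 addrC; apply: le_trans (expR_ge1Dx _) _.
    by rewrite ler_expR.
  apply: (@le_trans _ _ (expR K%:R ^+ K)).
    rewrite lerXn2r ?nnegrE ?expR_ge0 //.
    by apply: le_trans (expR_ge1Dx _); rewrite lerDr.
  rewrite -expRM_natr ler_expR expr2; apply: ler_pM => //.
have twn : (tw n)^-1 <= expR (C * (1 + gamma ^+ 2 * u ^+ 2)).
  by rewrite -exprMn -lnE; apply: twC.
apply: (@le_trans _ _ (expR (u + u ^+ 2) * expR (- (u ^+ 3 / 2)) *
   expR (C * (1 + gamma ^+ 2 * u ^+ 2)))).
  apply: ler_pM => //; rewrite ?invr_ge0 ?(ltW tn) ?mulr_ge0 ?expR_ge0 //.
  apply: ler_pM => //; rewrite ?expR_ge0 // ler_expR mulNr lerN2 //.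
rewrite -!expRD.
apply: (@le_trans _ _ (expR (- u))).
  rewrite ler_expR; apply: exponent_below => //; first exact: sqr_ge0.
  lra.
rewrite expRN -[eps]invrK lef_pV2 ?posrE ?invr_gt0 ?expR_gt0 //.
by apply: le_trans (expR_ge1Dx _); lra.
Unshelve. all: by end_near. Qed.

(** Already the rarest tree is likely to be missing. Its size is at most
    [k n], which may be reduced to the integer after the threshold, so the cost
    of conditioning on that size is only [expR (O (x ^+ 2))]. *)
Lemma contains_all_above (k : nat -> nat) (delta : R) : 0 < delta ->
  (\forall n \near span_oo h, threshold gamma (1 - delta) n <= (k n)%:R) ->
  gw_cond_prob X n (contains_all X (k n)) @[n --> span_oo h] --> (0 : R).
Proof.
move=> d0 kthr; apply/cvgr0Pnorm_le => eps eps0.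
have [E E0 nearE] := near_pmin.
have [i0 hi0] : exists i0, forall j, (i0 <= j)%N -> [/\ `|e j| <= E, 0 < pmin X j &
    pmin X j = expR (- (gamma * ln j%:R * (j%:R + e j)))].
  by case: nearE => N _ hN; exists N.
have [C C0 twC] := tree_weight_inv_le law.
pose E' := E + i0%:R; have E'0 : 0 <= E' by rewrite addr_ge0.
pose delta' := Num.min delta 1.
have d'0 : 0 < delta' <= 1 by rewrite lt_min d0 ltr01 ge_min lexx orbT.
have B0 : 0 <= 5 * C + 1 by lra.
have near_cost := near_span_oo h (near_log_scale gamma_gt0
   (log_cost_above gamma_gt0 d'0 E'0 B0)).
have near_lnE := near_span_oo h (near_log_scaleE gamma_gt0).
have near_thr := near_span_oo h (near_thresholdE gamma_gt0).
have near_b := near_span_oo h (near_log_scale gamma_gt0 (near_basic (@ltr01 R))).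
have near_x := near_span_oo h (near_log_scale gamma_gt0 (near_pinfty_ge (2 * eps^-1))).
near=> n.
have [lnE nE] : ln n%:R = gamma * expR (log_scale gamma n) /\
  n%:R = expR (gamma * expR (log_scale gamma n)) by near: n.
have thrE : forall c, threshold gamma c n = scaled_threshold c (log_scale gamma n).
  by near: n.
have kthr' : threshold gamma (1 - delta) n <= (k n)%:R by near: n.
have xeps : 2 * eps^-1 <= log_scale gamma n by near: n.
have [thE thu cost] : [/\ 1 + E' <= scaled_threshold (1 - delta') (log_scale gamma n),
   scaled_threshold (1 - delta') (log_scale gamma n) <= expR (log_scale gamma n) &
   forall k : R, scaled_threshold (1 - delta') (log_scale gamma n) <= k ->
   gamma * expR (log_scale gamma n) + (5 * C + 1) * log_scale gamma n ^+ 2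
   <= gamma * ln k * (k - E')] by near: n.
have [x2 l1 _ hD] : [/\ 2 <= log_scale gamma n, 1 <= ln (log_scale gamma n),
   ln (log_scale gamma n) <= 1 * log_scale gamma n &
   log_scale gamma n / 2 <= log_scale gamma n - ln (log_scale gamma n)] by near: n.
have thk : scaled_threshold (1 - delta') (log_scale gamma n) <= (k n)%:R.
  apply: le_trans kthr'; rewrite thrE; apply: scaled_threshold_anti => //.
  by rewrite lerD2l lerN2 ge_min lexx.
rewrite ger0_norm ?(gw_cond_prob_ge0 X_iid) //.
move: (log_scale gamma n) lnE nE thE thu cost x2 xeps thk {thrE kthr' l1 hD} => x.
set th := scaled_threshold _ x; set u := expR x.
move=> lnE nE thE thu cost x2 xeps thk.
pose K := minn (k n) (Num.truncn th).+1.
have thK : th <= K%:R.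
  by rewrite /K; case: leqP => // _; apply/ltW/truncnS_gt.
have Kth : K%:R <= th + 1.
  apply: (@le_trans _ _ (Num.truncn th).+1%:R); first by rewrite ler_nat geq_minr.
  by rewrite -natr1 lerD2r truncn_le; lra.
have K1 : 1 <= K%:R :> R by lra.
have K0 : (0 < K)%N by rewrite -(ler_nat R).
have Ki0 : (i0 <= K)%N by rewrite -(ler_nat R); move: thE; rewrite /E'; lra.
have [eE pk pkE] := hi0 K Ki0.
have [s hs ws] := pmin_near_attained X_iid law K0 pk.
have sub : gw_cond_prob X n (contains_all X (k n)) <=
    gw_cond_prob X n (contains_all X K).
  apply: (le_gw_cond_prob X_iid) => t _; apply: (contains_all_antitone X_iid).
  exact: geq_minl.
apply: (le_trans sub); apply: le_trans (prob_contains_all X_iid n hs) _.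
have /(SplusE X_iid)[sK sw] := hs.
have x0 : 0 <= x by lra.
have twn : (tw (Defs.tsize s))^-1 <= expR (C * (1 + (2 * x) ^+ 2)).
  have ts : 0 < tw (Defs.tsize s).
    rewrite -size_code; apply: lt_le_trans sw _.
    by apply: weight_le_tree_weight => //; apply: codes_forest_code1.
  apply: twC => //; have s0 : (0 < Defs.tsize s)%N by case: (s).
  rewrite -[leRHS]expRK ler_ln ?posrE ?expR_gt0 ?ltr0n //.
  apply: (@le_trans _ _ K%:R); first by rewrite ler_nat.
  have u1 : 1 + x <= u by apply: expR_ge1Dx.
  have -> : expR (2 * x) = u ^+ 2 by rewrite mulrC expRM_natr.
  have u2 : 2 <= u by lra.
  have : 2 * u <= u ^+ 2 by rewrite expr2 ler_wpM2r // (le_trans _ u2).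
  lra.
have Wn : n%:R * weight p (code s) <= 2 * expR (- ((5 * C + 1) * x ^+ 2)).
  apply: (@le_trans _ _ (n%:R * (2 * pmin X K))); first by rewrite ler_wpM2l // ltW.
  rewrite mulrCA ler_wpM2l // pkE nE -expRD ler_expR.
  have := cost K%:R thK.
  have : gamma * ln K%:R * (K%:R - E') <= gamma * ln K%:R * (K%:R + e K).
    rewrite ler_wpM2l ?mulr_ge0 ?(ltW gamma_gt0) ?ln_ge0 // lerD2l.
    have i00 : 0 <= i0%:R :> R by [].
    by move: eE; rewrite ler_norml /E' => /andP[]; lra.
  by lra.
apply: (@le_trans _ _ (2 * expR (- ((5 * C + 1) * x ^+ 2)) * expR (C * (1 + (2 * x) ^+ 2)))).
  apply: ler_pM => //; last by rewrite invr_ge0 tree_weight_ge0.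
  by rewrite mulr_ge0 // weight_ge0.
rewrite -mulrA -expRD.
apply: (@le_trans _ _ (2 * expR (- x))).
  rewrite ler_wpM2l // ler_expR; apply: exponent_above => //.
  by rewrite (le_trans _ x2) // ler1n.
rewrite -ler_pdivlMl // mulrC expRN -[eps / 2]invrK lef_pV2 ?posrE ?invr_gt0 ?divr_gt0 ?expR_gt0 //.
by rewrite invf_div; apply: le_trans (expR_ge1Dx _); lra.
Unshelve. all: by end_near. Qed.

End Threshold.

(** * The largest size up to which everything is contained *)

Lemma second_order_bound (R : realType) (eta a b y : R) : 0 <= eta <= 4^-1 ->
  `|1 - a| <= eta -> `|b| <= eta ->
  - ((1 + eta) * a) - b <= y -> y <= - ((1 - eta) * a) + b ->
  `|y - -1| <= 4 * eta.
Proof.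
move=> /andP[e0 e1]; rewrite !ler_norml => /andP[a1 a2] /andP[b1 b2] y1 y2.
have c1 : (1 + eta) * a <= (1 + eta) * (1 + eta) by rewrite ler_wpM2l //; lra.
have c2 : (1 - eta) * (1 - eta) <= (1 - eta) * a by rewrite ler_wpM2l //; lra.
have c3 : eta * eta <= eta * 4^-1 by rewrite ler_wpM2l.
have c4 : 0 <= eta * eta by rewrite mulr_ge0.
by clear -b1 b2 y1 y2 c1 c2 c3 c4 e0; apply/andP; split; lra.
Qed.

Section KmaxLimit.
Context (d : measure_display) (Omega : measurableType d) (R : realType)
  (P : probability Omega R).
Variables (xi : {RV P >-> nat}) (X : seq nat -> {RV P >-> nat}) (h : nat).
Hypothesis X_iid : iid_copies xi X.

Lemma Kmax_between (k k' : nat -> nat) :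
  gw_cond_prob X n (~` contains_all X (k n)) @[n --> span_oo h] --> (0 : R) ->
  gw_cond_prob X n (contains_all X (k' n)) @[n --> span_oo h] --> (0 : R) ->
  gw_cond_prob X n [set t | ~ (k n <= Kmax X t < k' n)%N] @[n --> span_oo h]
    --> (0 : R).
Proof.
move=> hk hk'.
have hs : gw_cond_prob X n (~` contains_all X (k n)) +
    gw_cond_prob X n (contains_all X (k' n)) @[n --> span_oo h] --> (0 : R).
  by rewrite -[X in _ --> X]addr0; apply: cvgD.
apply: (squeeze_cvgr _ (cvg_cst 0) hs); apply: nearW => n.
rewrite (gw_cond_prob_ge0 X_iid) /=.
apply: le_trans (gw_cond_probU X_iid _ _ _); apply: (le_gw_cond_prob X_iid) => t _.
move=> out; apply: contrapT => /not_orP[/contrapT inn nin].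
by apply: out; apply: (Kmax_bounds X_iid).
Qed.

Lemma near_scaled_threshold_ge (c A : R) :
  \forall x \near +oo, A <= scaled_threshold c x.
Proof.
have eta0 : 0 < (2 * (1 + `|c|))^-1 by rewrite invr_gt0 mulr_gt0 // ltr_pwDl.
have /cvgr0Pnorm_le/(_ _ eta0) rho_small := @cvg_rel_corr R.
near=> x.
have [x2 l1 _ hD] : [/\ 2 <= x, 1 <= ln x, ln x <= 1 * x & x / 2 <= x - ln x] by near: x; apply: near_basic.
have rs : `|rel_corr x| <= (2 * (1 + `|c|))^-1 by near: x.
have xA : 2 * `|A| <= x by near: x; apply: near_pinfty_ge.
have ex : 1 * x ^+ 2 <= expR x by near: x; apply: near_expR_ge.
have crho : c * rel_corr x <= 2^-1.
  apply: le_trans (ler_norm _) _; rewrite normrM.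
  apply: (@le_trans _ _ ((1 + `|c|) * (2 * (1 + `|c|))^-1)).
    by apply: ler_pM => //; rewrite lerDr.
  by rewrite invfM mulrCA divff ?mulr1 // gt_eqF // ltr_pwDl.
have D0 : 0 < x - ln x by lra.
have uD : x <= expR x / (x - ln x).
  rewrite ler_pdivlMr //; apply: le_trans ex; rewrite mul1r expr2.
  by rewrite ler_wpM2l //; lra.
apply: (@le_trans _ _ (x * 2^-1)); first by have := ler_norm A; lra.
by apply: ler_pM; lra.
Unshelve. all: by end_near. Qed.

Variable gamma : R.
Hypothesis gamma_gt0 : 0 < gamma.
Hypothesis below : forall (k : nat -> nat) (delta : R), (forall n, (0 < k n)%N) ->
  k n @[n --> span_oo h] --> \oo -> 0 < delta ->
  (\forall n \near span_oo h, (k n)%:R <= threshold gamma (1 + delta) n) ->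
  gw_cond_prob X n (~` contains_all X (k n)) @[n --> span_oo h] --> (0 : R).
Hypothesis above : forall (k : nat -> nat) (delta : R), 0 < delta ->
  (\forall n \near span_oo h, threshold gamma (1 - delta) n <= (k n)%:R) ->
  gw_cond_prob X n (contains_all X (k n)) @[n --> span_oo h] --> (0 : R).

(** Rounding the thresholds to integers costs the summands 1. *)
Lemma Kmax_sandwich (delta : R) : 0 < delta ->
  gw_cond_prob X n [set t | ~ (threshold gamma (1 + delta) n - 1 <= (Kmax X t)%:R
     <= threshold gamma (1 - delta) n + 1)] @[n --> span_oo h] --> (0 : R).
Proof.
move=> d0.
pose k n := maxn 1 (Num.truncn (threshold gamma (1 + delta) n)).
pose k' n := (Num.truncn (threshold gamma (1 - delta) n)).+1.
have near_thr := near_span_oo h (near_thresholdE gamma_gt0).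
have thr_big c A : \forall n \near span_oo h, A <= threshold gamma c n.
  near=> n.
  have -> : threshold gamma c n = scaled_threshold c (log_scale gamma n).
    have thrE : forall c, threshold gamma c n = scaled_threshold c (log_scale gamma n).
      by near: n.
    exact: thrE.
  near: n; apply: near_span_oo.
  exact: (near_log_scale gamma_gt0 (near_scaled_threshold_ge c A)).
have hk : gw_cond_prob X n (~` contains_all X (k n)) @[n --> span_oo h] --> (0 : R).
  apply: (below (delta := delta)) => //.
  - by move=> n; rewrite leq_max.
  - apply/cvgnyPge => A; near=> n.
    have tA : A%:R <= threshold gamma (1 + delta) n by near: n; apply: thr_big.
    rewrite /k leq_max; apply/orP; right.
    by rewrite truncn_ge_nat //; apply: le_trans tA.
  - near=> n.
    have t1 : 1 <= threshold gamma (1 + delta) n by near: n; apply: thr_big.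
    by rewrite /k; case: leqP => // _; rewrite truncn_le; lra.
have hk' : gw_cond_prob X n (contains_all X (k' n)) @[n --> span_oo h] --> (0 : R).
  by apply: (above (delta := delta)) => //; apply: nearW => n; apply/ltW/truncnS_gt.
apply: (squeeze_cvgr _ (cvg_cst 0) (Kmax_between hk hk')); near=> n.
rewrite (gw_cond_prob_ge0 X_iid) /=; apply: (le_gw_cond_prob X_iid) => t _ /=.
apply: contra_not => /andP[kK Kk']; apply/andP; split.
  rewrite lerBlDr natr1; apply: le_trans (ltW (truncnS_gt _)) _.
  by rewrite ler_nat ltnS; apply: leq_trans kK; rewrite /k leq_max leqnn orbT.
have t0 : 0 <= threshold gamma (1 - delta) n by near: n; apply: thr_big.
have : (Kmax X t)%:R <= (Num.truncn (threshold gamma (1 - delta) n))%:R :> R.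
  by rewrite ler_nat -ltnS.
by have := truncn_le (threshold gamma (1 - delta) n); rewrite t0; lra.
Unshelve. all: by end_near. Qed.

(** A function of [Kmax] that is uniformly close to [c] between the two
    thresholds converges to [c] in probability. *)
Lemma cvg_in_prob_Kmax (g : nat -> R -> R) (c : R) :
  (forall eps, 0 < eps -> exists2 delta, 0 < delta & \forall n \near span_oo h,
    forall K, threshold gamma (1 + delta) n - 1 <= K ->
      K <= threshold gamma (1 - delta) n + 1 -> `|g n K - c| <= eps) ->
  cvg_in_prob X h (fun n t => g n (Kmax X t)%:R) c.
Proof.
move=> hg eps eps0; have [delta d0 gn] := hg eps eps0.
apply: (squeeze_cvgr _ (cvg_cst 0) (Kmax_sandwich d0)); near=> n.
rewrite (gw_cond_prob_ge0 X_iid) /=; apply: (le_gw_cond_prob X_iid) => t _ /=.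
move=> far /andP[lo hi]; move: far; rewrite ltNge => /negP; apply.
have gnK : forall K, threshold gamma (1 + delta) n - 1 <= K ->
      K <= threshold gamma (1 - delta) n + 1 -> `|g n K - c| <= eps by near: n.
exact: gnK.
Unshelve. all: by end_near. Qed.

Lemma Kmax_first_order : cvg_in_prob X h
  (fun n t => (Kmax X t)%:R * (ln (ln n%:R) / ln n%:R)) (1 / gamma).
Proof.
apply: (cvg_in_prob_Kmax (g := fun n K => K * (ln (ln n%:R) / ln n%:R))).
move=> eps eps0; exists 1 => //.
have /cvgrPdist_le/(_ _ eps0) lo := @cvg_threshold R gamma (1 + 1) (- 1) gamma_gt0.
have /cvgrPdist_le/(_ _ eps0) hi := @cvg_threshold R gamma (1 - 1) 1 gamma_gt0.
have near_lo := near_span_oo h (near_log_scale gamma_gt0 lo).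
have near_hi := near_span_oo h (near_log_scale gamma_gt0 hi).
have near_lnE := near_span_oo h (near_log_scaleE gamma_gt0).
have near_thr := near_span_oo h (near_thresholdE gamma_gt0).
have near_x := near_span_oo h (near_log_scale gamma_gt0 (near_pinfty_ge (- ln gamma))).
near=> n => K.
have [lnE _] : ln n%:R = gamma * expR (log_scale gamma n) /\
  n%:R = expR (gamma * expR (log_scale gamma n)) by near: n.
have thrE : forall c, threshold gamma c n = scaled_threshold c (log_scale gamma n).
  by near: n.
have x0 : - ln gamma <= log_scale gamma n by near: n.
have {}lo : `|1 / gamma - (scaled_threshold (1 + 1) (log_scale gamma n) + - 1) *
   ((log_scale gamma n + ln gamma) / (gamma * expR (log_scale gamma n)))| <= eps.
  by near: n.
have {}hi : `|1 / gamma - (scaled_threshold (1 - 1) (log_scale gamma n) + 1) *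
   ((log_scale gamma n + ln gamma) / (gamma * expR (log_scale gamma n)))| <= eps.
  by near: n.
rewrite !thrE lnE lnM ?posrE ?expR_gt0 // expRK [ln gamma + _]addrC.
set w := (_ + ln gamma) / _ in lo hi *.
have w0 : 0 <= w by rewrite divr_ge0 ?mulr_ge0 ?expR_ge0 ?(ltW gamma_gt0) //; lra.
move=> Klo Khi; have := ler_wpM2r w0 Klo; have := ler_wpM2r w0 Khi.
move: lo hi; rewrite !ler_norml => /andP[lo1 lo2] /andP[hi1 hi2] h1 h2.
by apply/andP; split; lra.
Unshelve. all: by end_near. Qed.

Lemma Kmax_second_order : cvg_in_prob X h
  (fun n t =>
     ((Kmax X t)%:R * gamma *
        (ln (ln n%:R / gamma) - ln (ln (ln n%:R / gamma))) / ln n%:R - 1) *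
     (ln (ln n%:R) ^+ 2 / ln (ln (ln n%:R)))) (-1).
Proof.
apply: (cvg_in_prob_Kmax (g := fun n K => (K * gamma *
        (ln (ln n%:R / gamma) - ln (ln (ln n%:R / gamma))) / ln n%:R - 1) *
     (ln (ln n%:R) ^+ 2 / ln (ln (ln n%:R))))).
move=> eps eps0; pose eta := Num.min eps 1 / 4.
have m0 : 0 < Num.min eps 1 by rewrite lt_min eps0 ltr01.
have [me m1] : Num.min eps 1 <= eps /\ Num.min eps 1 <= 1 by rewrite !ge_min !lexx orbT.
have eta0 : 0 < eta by rewrite divr_gt0.
have eta1 : eta <= 4^-1 by rewrite /eta; lra.
have etae : 4 * eta <= eps by rewrite /eta; lra.
exists eta => //.
have /cvgrPdist_le/(_ _ eta0) lo := @cvg_corr_scale R (ln gamma).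
have /cvgrPdist_le/(_ _ eta0) hi := @cvg_rounding_scale R (ln gamma).
have near_lo := near_span_oo h (near_log_scale gamma_gt0 lo).
have near_hi := near_span_oo h (near_log_scale gamma_gt0 hi).
have near_lnE := near_span_oo h (near_log_scaleE gamma_gt0).
have near_thr := near_span_oo h (near_thresholdE gamma_gt0).
have near_b := near_span_oo h (near_log_scale gamma_gt0 (near_basic (@ltr01 R))).
have near_x := near_span_oo h (near_log_scale gamma_gt0 (near_pinfty_ge (1 - ln gamma))).
near=> n => K.
have [lnE _] : ln n%:R = gamma * expR (log_scale gamma n) /\
  n%:R = expR (gamma * expR (log_scale gamma n)) by near: n.
have thrE : forall c, threshold gamma c n = scaled_threshold c (log_scale gamma n).
  by near: n.
have [x2 l1 _ hD] : [/\ 2 <= log_scale gamma n, 1 <= ln (log_scale gamma n),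
   ln (log_scale gamma n) <= 1 * log_scale gamma n &
   log_scale gamma n / 2 <= log_scale gamma n - ln (log_scale gamma n)] by near: n.
have x0 : 1 - ln gamma <= log_scale gamma n by near: n.
have {}lo : `|1 - rel_corr (log_scale gamma n) *
    second_order_scale (ln gamma) (log_scale gamma n)| <= eta by near: n.
have {}hi : `|0 - (log_scale gamma n - ln (log_scale gamma n)) /
    expR (log_scale gamma n) * second_order_scale (ln gamma) (log_scale gamma n)|
    <= eta by near: n.
rewrite !thrE -/(log_scale gamma n).
have -> : ln (ln n%:R) = log_scale gamma n + ln gamma.
  by rewrite lnE lnM ?posrE ?expR_gt0 // expRK addrC.
rewrite lnE -/(second_order_scale _ _).
move: (log_scale gamma n) x2 l1 hD x0 lo hi {lnE thrE} => x x2 l1 hD x0 lo hi.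
set S := second_order_scale _ x in lo hi *.
have S0 : 0 <= S.
  rewrite /S /second_order_scale divr_ge0 ?sqr_ge0 // ln_ge0 //; lra.
have u0 := expR_gt0 x.
set D := x - ln x in hi *; have D0 : 0 < D by rewrite /D; lra.
have -> : K * gamma * D / (gamma * expR x) = K * (D / expR x).
  by field; rewrite !gt_eqF.
set v := D / expR x in hi *; have v0 : 0 < v by rewrite divr_gt0.
set rho := rel_corr x in lo.
have thv c : scaled_threshold c x * v = 1 - c * rho.
  rewrite /scaled_threshold -/D -/rho /v; field.
  by rewrite !gt_eqF.
move=> Klo Khi.
have := ler_wpM2r (ltW v0) Klo; have := ler_wpM2r (ltW v0) Khi.
rewrite mulrDl mulrBl !thv !mul1r => h1 h2.
have h1' : K * v - 1 <= - ((1 - eta) * rho) + v by lra.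
have h2' : - ((1 + eta) * rho) - v <= K * v - 1 by lra.
have := ler_wpM2r S0 h1'; have := ler_wpM2r S0 h2'.
have -> : (- ((1 + eta) * rho) - v) * S = - ((1 + eta) * (rho * S)) - v * S by ring.
have -> : (- ((1 - eta) * rho) + v) * S = - ((1 - eta) * (rho * S)) + v * S by ring.
move=> g2 g1; rewrite sub0r normrN in hi.
apply: le_trans etae; apply: second_order_bound lo hi g2 g1.
by rewrite (ltW eta0).
Unshelve. all: by end_near. Qed.

End KmaxLimit.

Theorem theorem9 (d : measure_display) (Omega : measurableType d)
    (R : realType) (P : probability Omega R)
    (xi : {RV P >-> nat}) (X : seq nat -> {RV P >-> nat}) (h : nat)
    (gamma : R) (e : nat -> R)
    (xi_mean : ('E_P[fun w => (xi w)%:R : R] = 1)%E)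
    (xi_var_gt0 : (0 < 'V_P[fun w => (xi w)%:R : R])%E)
    (xi_var_fin : ('V_P[fun w => (xi w)%:R : R] < +oo)%E)
    (X_iid : iid_copies xi X)
    (h_span : is_span xi h)
    (gamma_gt0 : 0 < gamma)
    (e_bounded : e =O_\oo (fun=> 1 : R))
    (pmin_asymp : \forall i \near \oo,
       ln (1 / pmin X i) = gamma * ln i%:R * (i%:R + e i)) :
  (forall k : nat -> nat,
     (forall n, (0 < k n)%N) ->
     k n @[n --> span_oo h] --> \oo ->
     forall delta : R, 0 < delta ->
       ((\forall n \near span_oo h,
           (k n)%:R <= threshold gamma (1 + delta) n) ->
        whp X h (fun n => contains_all X (k n))) /\
       ((\forall n \near span_oo h,
           threshold gamma (1 - delta) n <= (k n)%:R) ->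
        whp X h (fun n => ~` contains_all X (k n)))) /\
  cvg_in_prob X h
    (fun n t => (Kmax X t)%:R * (ln (ln n%:R) / ln n%:R))
    (1 / gamma) /\
  cvg_in_prob X h
    (fun n t =>
       ((Kmax X t)%:R * gamma *
          (ln (ln n%:R / gamma) - ln (ln (ln n%:R / gamma))) / ln n%:R - 1) *
       (ln (ln n%:R) ^+ 2 / ln (ln (ln n%:R))))
    (-1).
Proof.
have law := critical_law_offspring xi_mean xi_var_gt0 xi_var_fin.
have below := contains_all_below X_iid h_span gamma_gt0 e_bounded pmin_asymp law.
have above := contains_all_above X_iid gamma_gt0 e_bounded pmin_asymp law.
split; last first.
  split; [apply: (Kmax_first_order X_iid gamma_gt0 below (above h))
         |apply: (Kmax_second_order X_iid gamma_gt0 below (above h))].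
move=> k k0 koo delta d0; split=> kthr; apply: (whp_complement X_iid h_span law).
  exact: (below k delta).
apply: cvg_trans (above h k delta d0 kthr); apply: near_eq_cvg.
by apply: nearW => n; rewrite setCK.
Qed.
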